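(* Let $p$ be a prime, $d$ an odd prime with $p\equiv1\bmod d$, $a\in\mathbb{Z}$ with $1<a<d$, and $b:=d+1-a$. Let $X$ be the smooth projective model over $\mathbb{Q}_p$ of the affine curve $y^d=x^a(x-1)^b$. The formal power series $$l_1(X)=\sum_{k=0}^\infty\frac1{p^k}\binom{\frac{p^k-1}{d}b}{\frac{p^k-1}{d}}X^{p^k}$$ is the logarithm of a formal group over $\mathbb{Z}_p$, which is isomorphic to $\hat{J}_{X,1}/\mathbb{Z}_p$.
   Context: $X$ has genus $g=(d-1)/2$, good reduction at $p$, and a unique point $\infty$ not above the affine curve. Convention: $\binom00=1$. Let $\zeta_d\in\mathbb{Z}_p$ be a primitive $d$-th root of unity and $\delta$ the automorphism $(x,y)\mapsto(x,\zeta_dy)$ of $X$. Let $\hat{J}_X/\mathbb{Z}_p$ be the formal group of the Jacobian variety of $X$ (formal completion of its Néron model along the zero section). Definition of $\hat{J}_{X,i}$: embed the function field of $X$ in $\mathbb{Q}_p((\frac1T))$ by expanding at $\infty$ in the local parameter $\frac1T=x/y$ (so that $y=Tx$, and $\delta^*$ becomes $T\mapsto\zeta_dT$). Let $A\subset\mathbb{Q}_p((\frac1T))$ be the image of $H^0(X\setminus\{\infty\},\mathcal{O}_X)$ and let $1=\mu_1<\cdots<\mu_g$ be the Weierstrass gaps of $X$ at $\infty$, i.e. the $n\ge0$ with $H^0(X,\mathcal{O}_X(n\infty))=H^0(X,\mathcal{O}_X((n-1)\infty))$. Then $\mathbb{Q}_p((\frac1T))=A\oplus\frac1T\mathbb{Q}_p[[\frac1T]]\oplus\bigoplus_{i=1}^g\mathbb{Q}_pT^{\mu_i}$,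 and for each $k\ge0$ there are $e^{(k)}_{ii}\in\mathbb{Z}_p$ with $T^{\mu_ip^k}-e^{(k)}_{ii}T^{\mu_i}\in A\oplus\frac1T\mathbb{Q}_p[[\frac1T]]$. The series $\sum_{k\ge0}\frac{e_{ii}^{(k)}}{p^k}X^{p^k}$ is the logarithm of a one-dimensional formal group $\hat{J}_{X,i}$ over $\mathbb{Z}_p$, and $\hat{J}_X\cong\bigoplus_{i=1}^g\hat{J}_{X,i}$ as formal groups over $\mathbb{Z}_p$. *)

(* Defs.v *)
From HB Require Import structures.
From mathcomp Require Import all_boot all_order all_algebra.
From mathcomp Require Import boolp.
From mathcomp Require Import mpoly.

Set Implicit Arguments.
Unset Strict Implicit.
Unset Printing Implicit Defensive.

Import Order.TTheory GRing.Theory Num.Theory.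
Local Open Scope ring_scope.

Section ClassicalUnits.
Variable R : comNzRingType.
Implicit Types x y : R.

Definition cunit x : bool := `[< exists y, y * x = 1 >].
Definition cinv x : R :=
  if pselect (exists y, y * x = 1) is left e then projT1 (cid e) else x.

Lemma cmulVr x : cunit x -> cinv x * x = 1.
Proof.
move=> /asboolP ux; rewrite /cinv; case: pselect => // e.
exact: projT2 (cid e).
Qed.

Lemma cunitP x y : y * x = 1 -> cunit x.
Proof. by move=> yx1; apply/asboolP; exists y. Qed.

Lemma cinv_out x : ~~ cunit x -> cinv x = x.
Proof. by move/asboolP; rewrite /cinv; case: pselect. Qed.
End ClassicalUnits.

Lemma modz_dvdm (m d e : int) : (d %| e)%Z -> ((m %% e)%Z = m %[mod d])%Z.
Proof. by case/dvdzP=> q ->; rewrite {2}(divz_eq m (q * d)) mulrA modzMDl. Qed.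

(* Z_p is the inverse limit of the rings Z / p ^ n; pres x n is the           *)
(* representative in [0, p ^ n) of the residue of x modulo p ^ n.             *)
Record padic_int (p : nat) (p_pr : prime p) := PadicInt {
  pres : nat -> int;
  presP : forall n, pres n = (pres n.+1 %% (p ^ n)%N)%Z
}.

Section PadicInt.
Variables (p : nat) (p_pr : prime p).
Local Notation Zp := (padic_int p_pr).
Implicit Types x y z : Zp.

HB.instance Definition _ := gen_eqMixin Zp.
HB.instance Definition _ := gen_choiceMixin Zp.

Lemma padic_ext x y : pres x =1 pres y -> x = y.
Proof.
case: x y => [f fP] [g gP] /= /funext fg; rewrite {}fg in fP *.
by congr PadicInt; exact: Prop_irrelevance.
Qed.

Lemma presK x n : (pres x n %% (p ^ n)%N)%Z = pres x n.
Proof. by rewrite presP modz_mod. Qed.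

Lemma pres_le x m n : (m <= n)%N -> (pres x n %% (p ^ m)%N)%Z = pres x m.
Proof.
elim: n => [|n IHn]; first by rewrite leqn0 => /eqP->; rewrite presK.
rewrite leq_eqVlt => /predU1P[->|]; first by rewrite presK.
rewrite ltnS => le_mn; rewrite -(IHn le_mn) [pres x n]presP modz_dvdm //.
by rewrite dvdzE !absz_nat dvdn_exp2l.
Qed.

Definition coherent (f : nat -> int) :=
  forall n, (f n = f n.+1 %[mod (p ^ n)%N])%Z.

Fact padic_of_subproof f (cf : coherent f) n :
  (f n %% (p ^ n)%N)%Z = ((f n.+1 %% (p ^ n.+1)%N)%Z %% (p ^ n)%N)%Z.
Proof.
by rewrite cf [RHS]modz_dvdm // dvdzE !absz_nat dvdn_exp2l.
Qed.

Definition padic_of f (cf : coherent f) : Zp := PadicInt p_pr (padic_of_subproof cf).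

Fact cst_coherent (c : int) : coherent (fun=> c).
Proof. by []. Qed.
Fact add_coherent x y : coherent (fun n => pres x n + pres y n).
Proof. by move=> n; rewrite (presP x) (presP y) modzDm. Qed.
Fact opp_coherent x : coherent (fun n => - pres x n).
Proof. by move=> n; rewrite (presP x) modzNm. Qed.
Fact mul_coherent x y : coherent (fun n => pres x n * pres y n).
Proof. by move=> n; rewrite (presP x) (presP y) modzMm. Qed.

Definition padic_cst c := padic_of (cst_coherent c).
Definition padic_add x y := padic_of (add_coherent x y).
Definition padic_opp x := padic_of (opp_coherent x).
Definition padic_mul x y := padic_of (mul_coherent x y).

Fact padic_addA : associative padic_add.
Proof. by move=> x y z; apply: padic_ext => n /=; rewrite modzDml modzDmr addrA. Qed.
Fact padic_addC : commutative padic_add.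
Proof. by move=> x y; apply: padic_ext => n /=; rewrite addrC. Qed.
Fact padic_add0 : left_id (padic_cst 0) padic_add.
Proof. by move=> x; apply: padic_ext => n /=; rewrite modzDml add0r presK. Qed.
Fact padic_addN : left_inverse (padic_cst 0) padic_opp padic_add.
Proof. by move=> x; apply: padic_ext => n /=; rewrite modzDml addNr. Qed.

HB.instance Definition _ :=
  GRing.isZmodule.Build Zp padic_addA padic_addC padic_add0 padic_addN.

Fact padic_mulA : associative padic_mul.
Proof. by move=> x y z; apply: padic_ext => n /=; rewrite modzMml modzMmr mulrA. Qed.
Fact padic_mulC : commutative padic_mul.
Proof. by move=> x y; apply: padic_ext => n /=; rewrite mulrC. Qed.
Fact padic_mul1 : left_id (padic_cst 1) padic_mul.
Proof. by move=> x; apply: padic_ext => n /=; rewrite modzMml mul1r presK. Qed.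
Fact padic_mulD : left_distributive padic_mul padic_add.
Proof.
by move=> x y z; apply: padic_ext => n /=; rewrite modzMml modzDm mulrDl.
Qed.
Fact padic_1neq0 : padic_cst 1 != 0.
Proof.
apply/eqP=> /(congr1 (fun x => pres x 1)) /=.
by rewrite expn1 mod0z modz_small // ltz_nat prime_gt1.
Qed.

HB.instance Definition _ := GRing.Zmodule_isComNzRing.Build Zp
  padic_mulA padic_mulC padic_mul1 padic_mulD padic_1neq0.

HB.instance Definition _ := GRing.ComNzRing_hasMulInverse.Build Zp
  (@cmulVr Zp) (@cunitP Zp) (@cinv_out Zp).

Fact padic_domain : GRing.integral_domain_axiom Zp.
Proof.
move=> x y xy0; apply: contra_eqT xy0; rewrite negb_or => /andP[x0 y0].
have nz (z : Zp) : z != 0 -> exists n, pres z n != 0.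
  apply: contra_neqP => /forallNP z0; apply: padic_ext => n /=.
  by rewrite mod0z; have /negP := z0 n; rewrite negbK => /eqP.
have [m xm] := nz _ x0; have [n yn] := nz _ y0.
apply/eqP => /(congr1 (fun z => pres z (m + n)%N)) /= /eqP.
rewrite mod0z; apply/negP.
rewrite -(pres_le x (leq_addr n m)) in xm.
rewrite -(pres_le y (leq_addl m n)) in yn.
apply: contra xm => pxy.
have {}pxy : (p ^ (m + n) %| `|pres x (m + n)%N| * `|pres y (m + n)%N|)%N.
  by rewrite -abszM; rewrite -[(p ^ _)%N]absz_nat; apply/dvdz_mod0P/eqP.
apply/eqP/dvdz_mod0P; rewrite dvdzE absz_nat /=.
set u := `|pres x _|%N in pxy *; set v := `|pres y _|%N in pxy.
have pv : ~~ (p ^ n %| v)%N.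
  apply: contra yn => pv; apply/eqP/dvdz_mod0P.
  by rewrite dvdzE absz_nat.
have v_gt0 : (0 < v)%N by rewrite lt0n; apply: contra pv => /eqP->.
have [->//|u_gt0] := posnP u.
rewrite pfactor_dvdn // in pv; rewrite -ltnNge in pv.
rewrite pfactor_dvdn ?muln_gt0 ?u_gt0 // lognM // in pxy.
rewrite pfactor_dvdn // -(leq_add2r n); apply: leq_trans pxy _.
by rewrite leq_add2l ltnW.
Qed.

HB.instance Definition _ :=
  GRing.ComUnitRing_isIntegral.Build Zp padic_domain.
End PadicInt.

Definition padic (p : nat) (p_pr : prime p) : fieldType :=
  GRing.Field.clone {fraction padic_int p_pr} _.

Definition padic_of_int (p : nat) (p_pr : prime p) (z : padic_int p_pr) :
  padic p_pr := tofrac z.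

Record powser (R : Type) := Powser { pcoef : nat -> R }.

Section Powser.
Variable R : comNzRingType.
Implicit Types f g h : powser R.

HB.instance Definition _ := gen_eqMixin (powser R).
HB.instance Definition _ := gen_choiceMixin (powser R).

Lemma powser_ext f g : pcoef f =1 pcoef g -> f = g.
Proof. by case: f g => [f] [g] /= /funext->. Qed.

Definition powser_cst (c : R) := Powser (fun n => if n is 0%N then c else 0).
Definition powserX := Powser (fun n => (n == 1%N)%:R : R).
Definition powser_add f g := Powser (fun n => pcoef f n + pcoef g n).
Definition powser_opp f := Powser (fun n => - pcoef f n).
Definition powser_mul f g :=
  Powser (fun n => \sum_(j < n.+1) pcoef f j * pcoef g (n - j)%N).

Fact powser_addA : associative powser_add.
Proof. by move=> f g h; apply: powser_ext => n /=; rewrite addrA. Qed.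
Fact powser_addC : commutative powser_add.
Proof. by move=> f g; apply: powser_ext => n /=; rewrite addrC. Qed.
Fact powser_add0 : left_id (powser_cst 0) powser_add.
Proof. by move=> f; apply: powser_ext => -[|n] /=; rewrite add0r. Qed.
Fact powser_addN : left_inverse (powser_cst 0) powser_opp powser_add.
Proof. by move=> f; apply: powser_ext => -[|n] /=; rewrite addNr. Qed.

HB.instance Definition _ := GRing.isZmodule.Build (powser R)
  powser_addA powser_addC powser_add0 powser_addN.

Definition powser_trunc n f : {poly R} := \poly_(i < n) pcoef f i.

Lemma coef_powser_trunc n f i : (i < n)%N -> (powser_trunc n f)`_i = pcoef f i.
Proof. by move=> lt_in; rewrite coef_poly lt_in. Qed.

Lemma powser_mulE n m f g : (m < n)%N ->
  pcoef (powser_mul f g) m = (powser_trunc n f * powser_trunc n g)`_m.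
Proof.
move=> lt_mn; rewrite coefM; apply: eq_bigr => j _.
rewrite !coef_powser_trunc //; first exact: leq_ltn_trans (leq_subr _ _) lt_mn.
by apply: leq_ltn_trans lt_mn; rewrite -ltnS.
Qed.

Fact powser_mulC : commutative powser_mul.
Proof.
by move=> f g; apply: powser_ext => n; rewrite !(powser_mulE _ _ (ltnSn n)) mulrC.
Qed.
Fact powser_mulA : associative powser_mul.
Proof.
have mulM (n m : nat) (f g : powser R) (P : {poly R}) : (m < n)%N ->
    (powser_trunc n (powser_mul f g) * P)`_m
      = ((powser_trunc n f * powser_trunc n g) * P)`_m.
  move=> lt_mn; rewrite [LHS]coefM [RHS]coefM; apply: eq_bigr => j _.
  have lt_jn : (j < n)%N by apply: leq_ltn_trans lt_mn; rewrite -ltnS.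
  by rewrite coef_powser_trunc // (powser_mulE _ _ lt_jn).
move=> f g h; apply: powser_ext => n; rewrite !(powser_mulE _ _ (ltnSn n)).
by rewrite mulM // mulrC mulM // mulrC mulrA.
Qed.
Fact powser_mul1 : left_id (powser_cst 1) powser_mul.
Proof.
move=> f; apply: powser_ext => n /=; rewrite big_ord_recl /= mul1r subn0.
by rewrite big1 ?addr0 // => i _; rewrite mul0r.
Qed.
Fact powser_mulD : left_distributive powser_mul powser_add.
Proof.
move=> f g h; apply: powser_ext => n /=; rewrite -big_split /=.
by apply: eq_bigr => i _; rewrite mulrDl.
Qed.
Fact powser_1neq0 : powser_cst 1 != 0.
Proof. by apply/eqP=> /(congr1 (fun f => pcoef f 0)) /= /eqP; rewrite oner_eq0. Qed.

HB.instance Definition _ := GRing.Zmodule_isComNzRing.Build (powser R)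
  powser_mulA powser_mulC powser_mul1 powser_mulD powser_1neq0.

HB.instance Definition _ := GRing.ComNzRing_hasMulInverse.Build (powser R)
  (@cmulVr (powser R)) (@cunitP (powser R)) (@cinv_out (powser R)).
End Powser.

Fact powser_domain (R : idomainType) : GRing.integral_domain_axiom (powser R).
Proof.
move=> f g fg0; apply: contra_eqT fg0; rewrite negb_or => /andP[f0 g0].
have nz (h : powser R) : h != 0 -> exists n, pcoef h n != 0.
  apply: contra_neqP => /forallNP h0; apply: powser_ext => n.
  have /negP := h0 n; rewrite negbK => /eqP->; by case: n.
case/nz/ex_minnP: f0 => m fm min_m; case/nz/ex_minnP: g0 => n gn min_n.
apply/eqP => /(congr1 (fun h => pcoef h (m + n)%N)).
have lt_m : (m < (m + n).+1)%N by rewrite ltnS leq_addr.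
rewrite /= (bigD1 (Ordinal lt_m)) //= addKn big1 ?addr0 => [|i].
  have -> : (if (m + n)%N is 0%N then 0 else 0) = 0 :> R by case: (m + n)%N.
  by apply/eqP; rewrite mulf_neq0.
rewrite -val_eqE /= neq_ltn => /orP[lt_im|lt_mi].
  by have [->|/min_m] := eqVneq (pcoef f i) 0; rewrite ?mul0r // leqNgt lt_im.
have [->|/min_n] := eqVneq (pcoef g (m + n - i)%N) 0; first by rewrite mulr0.
rewrite leqNgt ltn_subLR ?(leq_trans _ (ltn_ord i)) //.
  by rewrite ltn_add2r lt_mi.
by rewrite -ltnS.
Qed.

HB.instance Definition _ (R : idomainType) :=
  GRing.ComUnitRing_isIntegral.Build (powser R) (@powser_domain R).

(* k((1/T)), with 1/T the variable of powser k *)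
Definition laurent (k : fieldType) : fieldType :=
  GRing.Field.clone {fraction powser k} _.

Section Curve.
Variable k : fieldType.
Local Notation L := (laurent k).

Definition lseries (f : powser k) : L := tofrac f.
Definition lcst (c : k) : L := lseries (powser_cst c).
Definition lT : L := (lseries (powserX k))^-1.

Definition lregular : {pred L} := fun f => `[< exists s, f = lseries s >].

Variables (d a b : nat) (x : L).

(* x and y = T x satisfy the equation of the curve and x has a pole, so that  *)
(* k(x, y) is the function field of X, expanded at the point that is not      *)
(* above the affine curve.                                                    *)
Definition expansion_at_infty : Prop :=
  (lT * x) ^+ d = x ^+ a * (x - 1) ^+ b /\ x \notin lregular.

Definition function_field : {pred L} := fun f => `[< forall E : {pred L},
  divring_closed E -> (forall c, lcst c \in E) -> x \in E -> lT * x \in E ->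
  f \in E >].

(* The closed points of the smooth projective curve X are the valuation rings *)
(* of its function field: these are the local rings O_{X,P}.                  *)
Record is_point (O : {pred L}) : Prop := IsPoint {
  point_sub : {subset O <= function_field};
  point_subring : subring_closed O;
  point_cst : forall c, lcst c \in O;
  point_proper : ~ {subset function_field <= O};
  point_val : {in function_field, forall f, f \in O \/ f^-1 \in O}
}.

Definition infty : {pred L} := [predI function_field & lregular].

(* H^0(X \ {infty}, O_X), as a subring of k((1/T)). *)
Definition sections_away_infty : {pred L} := fun f => `[< f \in function_field /\
  forall O : {pred L}, is_point O -> ~ (O =i infty) -> f \in O >].

(* H^0(X, O_X(n infty)): pole of order at most n at infty. *)
Definition sections_infty (n : int) : {pred L} :=
  [pred f in sections_away_infty | lT ^ (- n) * f \in lregular].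

Definition gap (n : nat) : Prop :=
  sections_infty n%:Z =i sections_infty (n%:Z - 1).

Definition gap_sequence (mu : seq nat) : Prop :=
  sorted ltn mu /\ forall n, n \in mu <-> gap n.

(* f \in A (+) (1/T) k[[1/T]] *)
Definition in_A_plus (f : L) : Prop :=
  exists2 g, g \in sections_away_infty & exists s, f = g + lT^-1 * lseries s.
End Curve.

Definition mseries (n : nat) (R : Type) := 'X_{1..n} -> R.

Section Mseries.
Variable R : comNzRingType.

Definition mtrunc n w (f : mseries n R) : {mpoly R[n]} :=
  \sum_(m : 'X_{1..n < w}) f m *: 'X_[m].

Definition mser0 n : mseries n R := fun=> 0.
Definition mserX n (i : 'I_n) : mseries n R := fun m => (m == U_(i)%MM)%:R.
Definition mser_add n (f g : mseries n R) : mseries n R := fun m => f m + g m.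

(* f(g_1, ..., g_r). This is only meaningful when the g_i have no constant    *)
(* term: then monomials of degree > |m| in f and in the g_i do not contribute *)
(* to the coefficient of X^m.                                                 *)
Definition mcomp r n (f : mseries r R) (g : r.-tuple (mseries n R)) :
    mseries n R := fun m =>
  (mtrunc (mdeg m).+1 f \mPo map_tuple (mtrunc (mdeg m).+1) g)@_m.
End Mseries.

Arguments mser0 R n : clear implicits.

Section FormalGroup.
Variable R : comNzRingType.

Local Notation V i := (mserX R (inord i%N)).

(* Commutative one-dimensional formal group laws F(X, Y) over R. *)
Record is_formal_group (F : mseries 2 R) : Prop := IsFormalGroup {
  fg_0r : mcomp F [tuple mserX R ord0; mser0 R 1] = mserX R ord0;
  fg_0l : mcomp F [tuple mser0 R 1; mserX R ord0] = mserX R ord0;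
  fg_C : mcomp F [tuple V 1; V 0] = F;
  fg_A : mcomp F [tuple mcomp F [tuple V 0; V 1]; V 2]
       = mcomp F [tuple V 0; mcomp F [tuple V 1; V 2]] :> mseries 3 R
}.

Record is_fg_hom (F G : mseries 2 R) (f : mseries 1 R) : Prop := IsFgHom {
  fgh_0 : f 0%MM = 0;
  fgh_mor : mcomp f [tuple F]
          = mcomp G [tuple mcomp f [tuple V 0]; mcomp f [tuple V 1]]
}.

Definition fg_isomorphic (F G : mseries 2 R) : Prop :=
  exists f g : mseries 1 R, [/\ is_fg_hom F G f, is_fg_hom G F g,
    mcomp g [tuple f] = mserX R ord0 & mcomp f [tuple g] = mserX R ord0].
End FormalGroup.

Section Log.
Variables (R K : comNzRingType) (emb : R -> K).
Local Notation V i := (mserX K (inord i%N)).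

Record is_log (l : mseries 1 K) (F : mseries 2 R) : Prop := IsLog {
  log_0 : l 0%MM = 0;
  log_1 : l U_(ord0)%MM = 1;
  log_mor : mcomp l [tuple emb \o F]
    = mser_add (mcomp l [tuple V 0]) (mcomp l [tuple V 1]) :> mseries 2 K
}.
End Log.

Section Jacobian.
Variables (p : nat) (p_pr : prime p).
Local Notation Zp := (padic_int p_pr).
Local Notation Qp := (padic p_pr).

(* sum_k (c_k / p^k) X^(p^k) *)
Definition ptypical_series (c : nat -> Zp) : mseries 1 Qp := fun m =>
  let n := mdeg m in let k := logn p n in
  if n == (p ^ k)%N then padic_of_int (c k) / p%:R ^+ k else 0.

(* G is the summand \hat J_{X,i}, where the gaps are indexed from i = 1. *)
Definition is_Jhat (d a b i : nat) (G : mseries 2 Zp) : Prop :=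
  exists (x : laurent Qp) (mu : seq nat) (e : nat -> Zp),
  let mui := nth 0%N mu i.-1 in
  [/\ expansion_at_infty d a b x,
      gap_sequence x mu,
      (0 < i <= size mu)%N,
      forall k, in_A_plus x
        (lT Qp ^+ (mui * p ^ k)%N - lcst (padic_of_int (e k)) * lT Qp ^+ mui) &
      is_formal_group G /\ is_log (@padic_of_int p p_pr) (ptypical_series e) G].
End Jacobian.

(* Main.v *)
From HB Require Import structures.
Require Import Defs.
From mathcomp Require Import all_boot all_order all_algebra.
From mathcomp Require Import boolp mpoly.
From mathcomp Require classical_sets.
From mathcomp Require Import zify ring.

Set Implicit Arguments.
Unset Strict Implicit.
Unset Printing Implicit Defensive.

Import Order.TTheory GRing.Theory Num.Theory.
Local Open Scope ring_scope.

(* Formal group: with N_k = (p^k - 1)/d the numbers c_k = binom(N_k b, N_k) are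
   prime to p and satisfy c_(k+1) c_(k-1) = c_k^2 mod p^k, because the quotients
   c_(k+1) / c_k are quotients of prime-to-p factorials, which are periodic
   modulo p^k. Hence there is r in Z_p with c_(k+1) = r c_k mod p^(k+1), i.e.
   l1(X) - (r/p) l1(X^p) is integral, and the functional equation argument
   makes l1^(-1)(l1(X) + l1(Y)) integral, degree by degree.

   Curve: with u = 1/x and s = 1/T one has u = s^d (1 - u)^b, so infty is the
   only place where x has a pole, x and y = T x lie in A, and expanding
   T^(p^k) = T (x (1 - u)^b)^(N_k) gives the coefficient (-1)^(N_k) c_k of T.
   It is determined because A has no element with a simple pole at infty:
   such an f would generate A, x = P(f) and y = Q(f) with
   Q^d = P^a (P - 1)^b, which is excluded by comparing degrees of derivatives.
   Both logarithms therefore coincide. *)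

(** * Congruences for binomial coefficients *)

(** Two obstacles shape the proof. Points of X are arbitrary valuation rings of the function field,
    and A is cut out by all of them. So x in A requires that a valuation ring omitting x be the one
    of infty: the two rings are compared on elements that have the same expansion in s = 1/T at
    both. Conversely, that a function in A cannot vanish at infty requires enough points:
    Chevalley's extension theorem, from Zorn's lemma, gives a valuation ring that contains k[1/f]
    and omits f.

    On the side of formal groups, all denominators sit in (r/p) l. For an integral polynomial A the
    polynomials A^p and A(X^p, Y^p) agree modulo p, because Frobenius is the identity on F_p.
    Replacing one by the other inside l therefore changes its value by a multiple of p, which
    cancels the denominator of r/p.

    Finally, [is_Jhat] allows any expansion x and any constants e, so both the existence of such
    data and their independence of choices have to be shown; the isomorphism then comes out as an
    equality of group laws. *)

Section UnitFactorial.
Local Open Scope nat_scope.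
Variables (p : nat) (p_pr : prime p).

(** Up to sign, Morita's p-adic gamma function at n + 1. *)
Definition unit_fact n := \prod_(1 <= i < n.+1 | ~~ (p %| i)) i.

Lemma unit_factS n :
  unit_fact n.+1 = unit_fact n * (if p %| n.+1 then 1 else n.+1).
Proof.
rewrite /unit_fact big_mkcond [in RHS]big_mkcond big_nat_recr //=.
by case: (p %| n.+1).
Qed.

(** The multiples of p up to n are p times the numbers up to n %/ p. *)
Lemma fact_unit_fact n : n`! = unit_fact n * p ^ (n %/ p) * (n %/ p)`!.
Proof.
elim: n => [|n IHn]; first by rewrite /unit_fact big_geq // div0n.
have p_gt0 := prime_gt0 p_pr.
rewrite factS IHn unit_factS divnS //.
case: ifP => [p_dvd|_] /=; last by rewrite add0n; ring.
have -> : n.+1 = p * (n %/ p).+1.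
  by rewrite -[(_ %/ _).+1]add1n -[1]/(true : nat) -p_dvd -divnS // mulnC divnK.
by rewrite add1n expnS factS; ring.
Qed.

Lemma coprime_unit_fact k n : coprime (p ^ k) (unit_fact n).
Proof.
apply: coprimeXl; elim: n => [|n IHn]; first by rewrite /unit_fact big_geq // coprimen1.
rewrite unit_factS coprimeMr IHn /=; case: ifP => [_|/negbT]; first exact: coprimen1.
by rewrite prime_coprime.
Qed.

(** For k > 0 the numbers i and i + p^k are congruent modulo p^k and divisible by p together. *)
Lemma unit_factD k m :
  0 < k -> unit_fact (m + p ^ k) = unit_fact m * unit_fact (p ^ k) %[mod p ^ k].
Proof.
move=> k_gt0; elim: m => [|m IHm]; first by rewrite {2}/unit_fact big_geq // mul1n.
rewrite addSn !unit_factS -addSn dvdn_addl ?dvdn_exp //.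
case: ifP => _; first by rewrite !muln1.
by rewrite -modnMm IHm modnDr modnMm; congr (_ %% _); ring.
Qed.

Lemma unit_factDM k m j : 0 < k ->
  unit_fact (m + j * p ^ k) = unit_fact m * unit_fact (p ^ k) ^ j %[mod p ^ k].
Proof.
move=> k_gt0; elim: j => [|j IHj]; first by rewrite addn0 muln1.
rewrite mulSn addnCA addnC unit_factD // -modnMml IHj modnMml.
by rewrite expnS; congr (_ %% _); ring.
Qed.
End UnitFactorial.

Lemma eqn_modMr_coprime q m n c : coprime q c ->
  (m * c = n * c %[mod q])%N -> (m = n %[mod q])%N.
Proof.
move=> co_qc /eqP; case: (leqP n m) => [le_nm|/ltnW le_mn] mod_eq; apply/eqP.
  by move: mod_eq; rewrite !eqn_mod_dvd ?leq_mul // -mulnBl Gauss_dvdl.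
move: mod_eq; rewrite eq_sym [in X in _ -> X]eq_sym.
by rewrite !eqn_mod_dvd ?leq_mul // -mulnBl Gauss_dvdl.
Qed.

Section BinomialCongruences.
Local Open Scope nat_scope.
Variables (p d b : nat) (p_pr : prime p) (p_mod_d : p = 1 %[mod d]).
Hypothesis b_bounds : 1 < b < d.

(** Under p = 1 mod d the division is exact, and the k digits in base p all equal (p - 1)/d, hence
    the name. *)
Definition rep_digit k := (p ^ k - 1) %/ d.
Local Notation N := rep_digit.

Lemma rep_digitK k : N k * d = p ^ k - 1.
Proof.
apply: divnK; rewrite -eqn_mod_dvd ?expn_gt0 ?prime_gt0 //.
by rewrite -modnXm p_mod_d modnXm exp1n.
Qed.

Let d_gt0 : 0 < d. Proof. by case/andP: b_bounds => _; apply: leq_ltn_trans. Qed.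

Lemma rep_digit0 : N 0 = 0.
Proof. by rewrite /N expn0 subnn div0n. Qed.

Lemma rep_digitS k : N k.+1 = N k * p + N 1.
Proof.
apply/eqP; rewrite -(eqn_pmul2r d_gt0) mulnDl mulnAC !rep_digitK expn1 expnSr.
have := prime_gt0 p_pr; have : 0 < p ^ k by rewrite expn_gt0 prime_gt0.
by set q := p ^ k => q_gt0 p_gt0; nia.
Qed.

(** The new digit is put on top here, at the bottom in [rep_digitS]: the periodicity of [unit_fact]
    needs the first form, division by p the second. *)
Lemma rep_digitSl k : N k.+1 = N k + N 1 * p ^ k.
Proof.
apply/eqP; rewrite -(eqn_pmul2r d_gt0) mulnDl [N 1 * _ * _]mulnAC !rep_digitK expn1 expnSr.
have := prime_gt0 p_pr; have : 0 < p ^ k by rewrite expn_gt0 prime_gt0.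
by set q := p ^ k => q_gt0 p_gt0; nia.
Qed.

(* The base-p digits of [c * N k] are all equal to [c * N 1]: no carry. *)
Lemma divn_rep_digit c k : c < d -> (N k.+1 * c) %/ p = N k * c.
Proof.
move=> lt_cd; rewrite rep_digitS mulnDl mulnAC divnMDl ?prime_gt0 //.
rewrite divn_small ?addn0 //.
have := rep_digitK 1; rewrite expn1 => Nd; have := prime_gt0 p_pr; nia.
Qed.

Definition cbin k := 'C(N k * b, N k).

(** Each factorial in the binomial is split by [fact_unit_fact]. Since no carry occurs, the powers
    of p cancel and the remaining factorials form [cbin k]. The quotient is stated cross-multiplied
    to stay in the natural numbers. *)
Lemma cbinS k : cbin k.+1 * (unit_fact p (N k.+1) * unit_fact p (N k.+1 * b.-1))
  = cbin k * unit_fact p (N k.+1 * b).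
Proof.
have [b1 bd] := andP b_bounds.
have sub_b n : n * b - n = n * b.-1 by rewrite -{2}(muln1 n) -mulnBr subn1.
have le_b n : n <= n * b by apply: leq_pmulr; apply: ltnW.
have fE n : 'C(n * b, n) * (n`! * (n * b.-1)`!) = (n * b)`!.
  by rewrite -sub_b bin_fact.
have := fE (N k.+1); have := fE (N k).
rewrite !(fact_unit_fact p_pr (N k.+1 * _)) (fact_unit_fact p_pr (N k.+1)).
have -> : N k.+1 %/ p = N k by have := @divn_rep_digit 1 k; rewrite !muln1 => ->//; lia.
rewrite !divn_rep_digit; try lia.
rewrite -/(cbin k) -/(cbin k.+1) => <-.
have -> : p ^ (N k * b) = p ^ (N k) * p ^ (N k * b.-1).
  by rewrite -expnD -mulnS prednK //; apply: ltnW.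
move=> fN.
have /eqP := fN; set X := p ^ N k; set Y := p ^ (N k * _).
set f1 := (N k)`!; set f2 := (N k * b.-1)`!.
have pos : 0 < X * Y * f1 * f2.
  by rewrite /X /Y /f1 /f2 !muln_gt0 !expn_gt0 !(prime_gt0 p_pr) !fact_gt0.
move=> E; apply/eqP; rewrite -(eqn_pmul2r pos).
apply/eqP; move/eqP: E => E.
transitivity (cbin k.+1 * (unit_fact p (N k.+1) * X * f1
  * (unit_fact p (N k.+1 * b.-1) * Y * f2))); first by ring.
by rewrite E; ring.
Qed.

Lemma coprime_cbin j k : coprime (p ^ j) (cbin k).
Proof.
apply: coprimeXl; elim: k => [|k IHk]; first by rewrite /cbin rep_digit0 bin0 coprimen1.
have := congr1 (coprime p) (cbinS k); rewrite !coprimeMr IHk.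
by have cu n := coprime_unit_fact p_pr 1 n; rewrite expn1 in cu; rewrite !cu !andbT.
Qed.

(** Passing from N_(k+1) to N_(k+2) multiplies each prime-to-p factorial by a power of W. The
    exponents N_1 b above and N_1 + N_1 (b - 1) below agree, so the ratio of consecutive [cbin] is
    unchanged modulo p^(k+1). *)
Lemma cbin_sqr k : cbin k.+2 * cbin k = cbin k.+1 * cbin k.+1 %[mod p ^ k.+1].
Proof.
pose W := unit_fact p (p ^ k.+1).
pose U := unit_fact p (N k.+1) * unit_fact p (N k.+1 * b.-1).
have coU : coprime (p ^ k.+1) (W ^ (N 1 * b) * U).
  by rewrite !coprimeMr coprimeXr !coprime_unit_fact.
apply: (eqn_modMr_coprime coU).
have [b1 bd] := andP b_bounds.
have uS c : unit_fact p (N k.+2 * c)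
    = unit_fact p (N k.+1 * c) * W ^ (N 1 * c) %[mod p ^ k.+1].
  by rewrite rep_digitSl mulnDl -unit_factDM // [N 1 * _ * c]mulnAC.
have US : unit_fact p (N k.+2) * unit_fact p (N k.+2 * b.-1)
    = U * W ^ (N 1 * b) %[mod p ^ k.+1].
  rewrite -{1}[N k.+2]muln1 -modnMm !uS modnMm !muln1.
  have -> : N 1 * b = N 1 + N 1 * b.-1 by rewrite -mulnS prednK //; apply: ltnW.
  by rewrite expnD /U; congr (_ %% _); ring.
have -> : cbin k.+2 * cbin k * (W ^ (N 1 * b) * U)
    = U * W ^ (N 1 * b) * (cbin k.+2 * cbin k) by ring.
rewrite -modnMml -US modnMml.
have -> : unit_fact p (N k.+2) * unit_fact p (N k.+2 * b.-1) * (cbin k.+2 * cbin k)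
    = unit_fact p (N k.+2 * b) * (cbin k.+1 * cbin k).
  by rewrite [RHS]mulnC [RHS]mulnAC -cbinS; ring.
rewrite -modnMml uS modnMml.
have -> : unit_fact p (N k.+1 * b) * W ^ (N 1 * b) * (cbin k.+1 * cbin k)
    = cbin k * unit_fact p (N k.+1 * b) * (cbin k.+1 * W ^ (N 1 * b)) by ring.
by rewrite -cbinS -/U; congr (_ %% _); ring.
Qed.
End BinomialCongruences.

(** * Divisibility and limits of ratios in Z_p *)

Section PadicCongruences.
Variables (p : nat) (p_pr : prime p).
Local Notation Zp := (padic_int p_pr).

Lemma pres_nat (m n : nat) : pres (m%:R : Zp) n = (m%:Z %% (p ^ n)%N)%Z.
Proof.
elim: m => [|m IHm] //.
by rewrite -addn1 natrD /= IHm modzDm PoszD.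
Qed.

(** The quotient modulo p^m is read off from x modulo p^(n+m), hence the shifted index in the
    coherent sequence. *)
Lemma pres_eq0_dvd (x : Zp) n : pres x n = 0 -> exists y, x = p%:R ^+ n * y.
Proof.
move=> x0; have p_gt0 := prime_gt0 p_pr.
have pn0 k : (p ^ k)%N%:Z != 0 by rewrite -lt0n expn_gt0 p_gt0.
have xdvd m : ((p ^ n)%N %| pres x (n + m)%N)%Z.
  by apply/dvdz_mod0P; rewrite pres_le ?leq_addr.
have coh : coherent p (fun m => (pres x (n + m)%N %/ (p ^ n)%N)%Z).
  move=> m; apply/eqP; rewrite eqz_mod_dvd -(dvdz_mul2l (pn0 n)).
  rewrite mulrBr ![(p ^ n)%N%:Z * (_ %/ _)%Z]mulrC !divzK //.
  by rewrite -PoszM -expnD -eqz_mod_dvd addnS [pres x (n + m)%N]presP modz_mod.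
exists (padic_of p_pr coh); apply: padic_ext => m.
rewrite -natrX /= pres_nat modzMml modzMmr mulrC divzK // pres_le //.
exact: leq_addl.
Qed.

Lemma padic_ratio_limit (c : nat -> nat) :
    (forall j k, coprime (p ^ j) (c k)) ->
    (forall k, c k.+2 * c k = c k.+1 * c k.+1 %[mod p ^ k.+1])%N ->
  exists r : Zp, forall k, exists z : Zp,
    (c k.+1)%:R - r * (c k)%:R = p%:R ^+ k.+1 * z.
Proof.
move=> co_c c_sqr.
have f_ex k : exists f : int, (f * c k = c k.+1 %[mod (p ^ k.+1)%N])%Z.
  have /coprimezP[[u v] /= uv] : coprimez (p ^ k.+1)%N (c k) by exact: co_c.
  exists ((c k.+1)%:Z * v); apply/eqP; rewrite eqz_mod_dvd; apply/dvdzP.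
  exists (- ((c k.+1)%:Z * u)); rewrite -mulrA.
  have -> : v * (c k)%:Z = 1 - u * (p ^ k.+1)%N%:Z by rewrite -uv addrAC subrr add0r.
  by ring.
have [f fP] := choice f_ex.
(* The ratio f k is determined modulo p^(k+1), so it sits at index k + 1; index 0 is modulo 1.
   Coherence is the square congruence after multiplication by the units c_(k+1) and c_k. *)
have coh : coherent p (fun n => if n is k.+1 then f k else 0).
  case=> [|k]; first by rewrite expn0 !modz1.
  apply/eqP; rewrite eqz_mod_dvd.
  rewrite -(Gauss_dvdzl _ (p := c k.+1)); last exact: co_c.
  rewrite -(Gauss_dvdzl _ (p := c k)); last exact: co_c.
  rewrite -mulrA mulrBl -eqz_mod_dvd.
  have f1 : (f k.+1 * c k.+1 = c k.+2 %[mod (p ^ k.+1)%N])%Z.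
    rewrite -(modz_dvdm (f k.+1 * _) (e := (p ^ k.+2)%N)) ?fP ?modz_dvdm //;
      by rewrite dvdzE !absz_nat dvdn_exp2l.
  have -> : f k * ((c k.+1)%:Z * (c k)%:Z) = f k * (c k)%:Z * (c k.+1)%:Z by ring.
  rewrite mulrA -modzMml fP modzMml -[X in _ == X]modzMml f1 modzMml.
  by rewrite -!PoszM !modz_nat c_sqr.
exists (padic_of p_pr coh) => k; apply: pres_eq0_dvd.
rewrite /= !pres_nat modzDm -modzDmr modzNm modzDmr.
by apply/dvdz_mod0P; rewrite -eqz_mod_dvd modzMm fP.
Qed.
End PadicCongruences.

(** * Composition of formal power series *)

Section Order.
Variables (R : comNzRingType) (n : nat).
Implicit Types (P Q : {mpoly R[n]}) (f g : mseries n R).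

(** Membership in the w-th power of the ideal of the variables. Identities of series are proved as
    congruences of polynomials modulo this power. *)
Definition mord w P := forall m, (mdeg m < w)%N -> P@_m = 0.
Definition approx w P f := forall m, (mdeg m < w)%N -> P@_m = f m.

Lemma mordW v w P : (v <= w)%N -> mord w P -> mord v P.
Proof. by move=> le_vw Pw m m_lt; apply: Pw; apply: leq_trans le_vw. Qed.

Lemma mord0 w : mord w 0.
Proof. by move=> m _; rewrite mcoeff0. Qed.

Lemma mordD w P Q : mord w P -> mord w Q -> mord w (P + Q).
Proof. by move=> Pw Qw m m_lt; rewrite mcoeffD Pw ?Qw ?addr0. Qed.

Lemma mordN w P : mord w P -> mord w (- P).
Proof. by move=> Pw m m_lt; rewrite mcoeffN Pw ?oppr0. Qed.

Lemma mordB w P Q : mord w P -> mord w Q -> mord w (P - Q).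
Proof. by move=> Pw Qw; apply/mordD/mordN. Qed.

Lemma mordZ w c P : mord w P -> mord w (c *: P).
Proof. by move=> Pw m m_lt; rewrite mcoeffZ Pw ?mulr0. Qed.

Lemma mord_sum w (I : Type) (r : seq I) (A : pred I) (F : I -> {mpoly R[n]}) :
  (forall i, A i -> mord w (F i)) -> mord w (\sum_(i <- r | A i) F i).
Proof. by move=> Fw; apply: big_ind => //; [apply: mord0 | apply: mordD]. Qed.

Lemma mordM v w P Q : mord v P -> mord w Q -> mord (v + w) (P * Q).
Proof.
move=> Pv Qw m m_lt; rewrite mcoeffM big1 // => -[k1 k2] /= /eqP mE.
have [lt_k1|le_k1] := ltnP (mdeg k1) v; first by rewrite Pv // mul0r.
rewrite [Q@_k2]Qw ?mulr0 //.
have k12 : (mdeg k1 + mdeg k2 < v + w)%N by rewrite -mdegD -mE.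
by rewrite -(ltn_add2l v); apply: leq_ltn_trans k12; rewrite leq_add2r.
Qed.

Lemma mordMl w P Q : mord w P -> mord w (P * Q).
Proof. by move=> Pw; rewrite -[w]addn0; apply: mordM. Qed.

Lemma mordMr w P Q : mord w Q -> mord w (P * Q).
Proof. by rewrite mulrC; apply: mordMl. Qed.

Lemma mordX w P k : mord w P -> mord (w * k) (P ^+ k).
Proof.
move=> Pw; elim: k => [|k IHk]; first by rewrite muln0.
by rewrite exprS mulnS; apply: mordM.
Qed.

Lemma mord_sym w P Q : mord w (P - Q) -> mord w (Q - P).
Proof. by move/mordN; rewrite opprB. Qed.

Lemma mord_subrr w P : mord w (P - P).
Proof. by rewrite subrr; apply: mord0. Qed.

Lemma mord_subM w P Q P' Q' :
  mord w (P - P') -> mord w (Q - Q') -> mord w (P * Q - P' * Q').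
Proof.
move=> PP QQ; have -> : P * Q - P' * Q' = (P - P') * Q + P' * (Q - Q') by ring.
by apply: mordD; [apply: mordMl | apply: mordMr].
Qed.

Lemma mord_subX w P Q k : mord w (P - Q) -> mord w (P ^+ k - Q ^+ k).
Proof. by move=> PQ; rewrite subrXX; apply: mordMl. Qed.

(** The cofactor of P - Q is a sum of products of k factors without constant term. These k extra
    degrees drive all the degree inductions below. *)
Lemma mord_subXS w P Q k : mord w (P - Q) -> mord 1 P -> mord 1 Q ->
  mord (w + k) (P ^+ k.+1 - Q ^+ k.+1).
Proof.
move=> PQ P1 Q1; rewrite subrXX; apply: mordM => //; apply: mord_sum => i _.
have /subnK {1}<- : (i <= k)%N by rewrite -ltnS.
have -> : (k.+1.-1 - i = k - i)%N by [].
by apply: mordM; rewrite -[X in mord X _]mul1n; apply: mordX.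
Qed.

Lemma approxP w P Q f : approx w P f -> mord w (P - Q) <-> approx w Q f.
Proof.
move=> Pf; split=> [PQ m m_lt|Qf m m_lt].
  by apply/eqP; rewrite -Pf // eq_sym -subr_eq0 -mcoeffB PQ.
by rewrite mcoeffB Pf // Qf // subrr.
Qed.

Lemma mcoeff_mtrunc w f m : (mtrunc w f)@_m = if (mdeg m < w)%N then f m else 0.
Proof.
rewrite /mtrunc; case: ifP => [m_lt|m_ge]; last first.
  rewrite raddf_sum big1 //= => k _; rewrite mcoeffZ mcoeffX.
  by case: eqP => [kE|]; rewrite ?mulr0 //; move: m_ge; rewrite -kE bmdeg.
rewrite raddf_sum (bigD1 (BMultinom m_lt)) //= mcoeffZ mcoeffX eqxx mulr1.
rewrite big1 ?addr0 // => k /eqP km; rewrite mcoeffZ mcoeffX.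
by case: eqP => [kE|]; rewrite ?mulr0 //; case: km; apply: val_inj.
Qed.

Lemma approx_mtrunc w f : approx w (mtrunc w f) f.
Proof. by move=> m m_lt; rewrite mcoeff_mtrunc m_lt. Qed.

Lemma approx_mord1 w P f : (0 < w)%N -> approx w P f -> f 0%MM = 0 -> mord 1 P.
Proof.
move=> w_gt0 Pf f0 m; rewrite ltnS leqn0 mdeg_eq0 => /eqP->.
by rewrite Pf ?mdeg0.
Qed.

Lemma approx_eq f g : (forall w, exists P, approx w.+1 P f /\ approx w.+1 P g) ->
  f = g.
Proof.
by move=> fg; apply: funext => m; have [P [Pf Pg]] := fg (mdeg m); rewrite -Pf ?Pg.
Qed.

Lemma approxD w P Q f g :
  approx w P f -> approx w Q g -> approx w (P + Q) (mser_add f g).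
Proof. by move=> Pf Qg m m_lt; rewrite mcoeffD Pf ?Qg. Qed.

Lemma approx_X w (i : 'I_n) : approx w 'X_i (mserX R i).
Proof. by move=> m _; rewrite mcoeffX eq_sym. Qed.

Lemma approx_0 w : approx w 0 (mser0 R n).
Proof. by move=> m _; rewrite mcoeff0. Qed.
End Order.

Section Comp.
Variable R : comNzRingType.

Lemma mord_prod_sub n w (I : Type) (r : seq I) (F G : I -> {mpoly R[n]}) :
  (forall i, mord w (F i - G i)) ->
  mord w (\prod_(i <- r) F i - \prod_(i <- r) G i).
Proof.
move=> FG; apply: (big_ind2 (fun x y => mord w (x - y))) => //.
  exact: mord_subrr.
by move=> *; apply: mord_subM.
Qed.

Lemma mord_prodX n r v (q : 'I_r -> {mpoly R[n]}) (m : 'X_{1..r}) :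
  (forall i, mord v (q i)) -> mord (v * mdeg m) (\prod_i q i ^+ m i).
Proof.
move=> qv; rewrite mdegE big_distrr /=.
apply: (big_ind2 (fun w P => mord w P)) => [|u P w Q|i _] //; first exact: mordM.
exact: mordX.
Qed.

Lemma comp_mordM r n v w (P : {mpoly R[r]}) (q : r.-tuple {mpoly R[n]}) :
  (forall i, mord v (tnth q i)) -> mord w P -> mord (v * w) (P \mPo q).
Proof.
move=> qv Pw; rewrite comp_mpolyE; apply: mord_sum => m _.
have [m_lt|m_ge] := ltnP (mdeg m) w; first by rewrite Pw // scale0r; apply: mord0.
by apply: mordZ; apply: mordW (leq_mul (leqnn v) m_ge) _; apply: mord_prodX.
Qed.

Lemma comp_mord r n w (P : {mpoly R[r]}) (q : r.-tuple {mpoly R[n]}) :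
  (forall i, mord 1 (tnth q i)) -> mord w P -> mord w (P \mPo q).
Proof. by move=> q1 Pw; rewrite -[w]mul1n; apply: comp_mordM. Qed.

Lemma comp_mord_arg r n w (P : {mpoly R[r]}) (q q' : r.-tuple {mpoly R[n]}) :
  (forall i, mord w (tnth q i - tnth q' i)) -> mord w ((P \mPo q) - (P \mPo q')).
Proof.
move=> qq; rewrite !comp_mpolyE -sumrB; apply: mord_sum => m _.
by rewrite -scalerBr; apply/mordZ/mord_prod_sub => i; apply: mord_subX.
Qed.

(** [mcomp] chooses a truncation for each monomial; here one truncation serves all monomials of
    degree below w, so that laws of polynomial substitution carry over to series. *)
Lemma approx_mcomp r n w (P : {mpoly R[r]}) f
    (q : r.-tuple {mpoly R[n]}) (g : r.-tuple (mseries n R)) :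
    approx w P f -> (forall i, approx w (tnth q i) (tnth g i)) ->
    (forall i, tnth g i 0%MM = 0) ->
  approx w (P \mPo q) (mcomp f g).
Proof.
move=> Pf qg g0 m m_lt; rewrite /mcomp.
set v := (mdeg m).+1; set t := map_tuple _ _.
have appW n' (S : {mpoly R[n']}) h : approx w S h -> approx v S h.
  by move=> Sh k k_lt; apply: Sh; apply: leq_trans k_lt _.
have q1 i : mord 1 (tnth q i).
  by apply: approx_mord1 (qg i) (g0 i); apply: leq_trans m_lt.
apply/eqP; rewrite -subr_eq0 -mcoeffB; apply/eqP.
have mv : (mdeg m < v)%N by [].
have -> : (P \mPo q) - (mtrunc v f \mPo t)
  = ((P - mtrunc v f) \mPo q) + ((mtrunc v f \mPo q) - (mtrunc v f \mPo t)).
  by rewrite raddfB /=; ring.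
suff: mord v (((P - mtrunc v f) \mPo q) + ((mtrunc v f \mPo q) - (mtrunc v f \mPo t))) by apply.
apply: mordD.
  by apply: comp_mord => //; apply/(approxP _ (appW _ _ _ Pf)); apply: approx_mtrunc.
apply: comp_mord_arg => i; rewrite tnth_map.
by apply/(approxP _ (appW _ _ _ (qg i))); apply: approx_mtrunc.
Qed.

Lemma comp_mpolyA r n s (P : {mpoly R[r]}) (q : r.-tuple {mpoly R[n]})
    (h : n.-tuple {mpoly R[s]}) :
  (P \mPo q) \mPo h = P \mPo map_tuple (fun Q => Q \mPo h) q.
Proof.
rewrite [P \mPo q]comp_mpolyE [in RHS]comp_mpolyE raddf_sum /=; apply: eq_bigr => m _.
rewrite linearZ /= rmorph_prod /=; congr (_ *: _); apply: eq_bigr => i _.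
by rewrite rmorphXn /= tnth_map.
Qed.

Lemma mcomp0 r n (f : mseries r R) (g : r.-tuple (mseries n R)) :
  (forall i, tnth g i 0%MM = 0) -> mcomp f g 0%MM = f 0%MM.
Proof.
move=> g0; have cf : approx 1 (f 0%MM)%:MP f.
  move=> m; rewrite ltnS leqn0 mdeg_eq0 => /eqP->.
  by rewrite mcoeffC eqxx mulr1.
have c0 i : approx 1 (tnth [tuple 0 | _ < r] i) (tnth g i).
  move=> m; rewrite ltnS leqn0 mdeg_eq0 => /eqP->.
  by rewrite tnth_mktuple mcoeff0 g0.
rewrite -(approx_mcomp cf c0) ?mdeg0 //.
by rewrite comp_mpolyC mcoeffC eqxx mulr1.
Qed.

Lemma mcompA r n s (f : mseries r R) (g : r.-tuple (mseries n R))
    (h : n.-tuple (mseries s R)) :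
    (forall i, tnth g i 0%MM = 0) -> (forall i, tnth h i 0%MM = 0) ->
  mcomp (mcomp f g) h = mcomp f (map_tuple (fun q => mcomp q h) g).
Proof.
move=> g0 h0; apply: approx_eq => w.
pose T k l (t : l.-tuple (mseries k R)) := map_tuple (mtrunc w.+1) t.
have TP k l (t : l.-tuple (mseries k R)) i : approx w.+1 (tnth (T k l t) i) (tnth t i).
  by rewrite tnth_map; apply: approx_mtrunc.
exists ((mtrunc w.+1 f \mPo T _ _ g) \mPo T _ _ h); split.
  by apply: approx_mcomp => //; apply: approx_mcomp => //; apply: approx_mtrunc.
rewrite comp_mpolyA; apply: approx_mcomp => [|i|i]; first exact: approx_mtrunc.
  by rewrite !tnth_map; apply: approx_mcomp => //; apply: approx_mtrunc.
by rewrite tnth_map mcomp0.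
Qed.

Lemma mcompD r n (f f' : mseries r R) (g : r.-tuple (mseries n R)) :
    (forall i, tnth g i 0%MM = 0) ->
  mcomp (mser_add f f') g = mser_add (mcomp f g) (mcomp f' g).
Proof.
move=> g0; apply: approx_eq => w.
have gP i : approx w.+1 (tnth (map_tuple (mtrunc w.+1) g) i) (tnth g i).
  by rewrite tnth_map; apply: approx_mtrunc.
exists ((mtrunc w.+1 f + mtrunc w.+1 f') \mPo map_tuple (mtrunc w.+1) g); split.
  by apply: approx_mcomp => //; apply: approxD; apply: approx_mtrunc.
rewrite raddfD /=.
by apply: approxD; apply: approx_mcomp => //; apply: approx_mtrunc.
Qed.

Lemma mcompX r n (i : 'I_r) (g : r.-tuple (mseries n R)) :
  (forall i, tnth g i 0%MM = 0) -> mcomp (mserX R i) g = tnth g i.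
Proof.
move=> g0; apply: approx_eq => w; pose t := map_tuple (mtrunc w.+1) g.
have gP j : approx w.+1 (tnth t j) (tnth g j).
  by rewrite tnth_map; apply: approx_mtrunc.
exists ('X_i \mPo t); split; first by apply: approx_mcomp => //; apply: approx_X.
by rewrite comp_mpolyXU -tnth_nth.
Qed.
End Comp.

Section CompMap.
Variables (R K : comNzRingType) (emb : {rmorphism R -> K}).
Hypothesis emb_inj : injective emb.

Lemma map_mcomp r n (f : mseries r R) (g : r.-tuple (mseries n R)) :
  emb \o mcomp f g
    = mcomp (emb \o f) (map_tuple (fun q : mseries n R => emb \o q : mseries n K) g).
Proof.
have mapT k v (h : mseries k R) : map_mpoly emb (mtrunc v h) = mtrunc v (emb \o h : mseries k K).
  apply/mpolyP => m; rewrite mcoeff_map_mpoly !mcoeff_mtrunc.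
  by case: ifP => // _; exact: rmorph0.
apply: funext => m; rewrite /mcomp /= -mcoeff_map_mpoly map_mpoly_comp //= mapT.
congr ((_ \mPo _)@_m); apply: eq_from_tnth => i.
by rewrite !tnth_map mapT.
Qed.
End CompMap.

Lemma forall_ord1 (P : 'I_1 -> Prop) : P ord0 -> forall i, P i.
Proof. by move=> P0 i; rewrite ord1. Qed.

Lemma forall_ord2 (P : 'I_2 -> Prop) : P ord0 -> P (inord 1) -> forall i, P i.
Proof.
move=> P0 P1 i; have [->//|i1] : i = ord0 \/ i = inord 1.
  by case: i => [[|[|//]] lt_i]; [left | right]; apply: val_inj; rewrite //= inordK.
by rewrite i1.
Qed.

Lemma mserX0 (R : comNzRingType) n (i : 'I_n) : mserX R i 0%MM = 0.
Proof. by rewrite /mserX eq_sym mnm1_eq0. Qed.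

Section Univariate.
Variable R : comNzRingType.
Implicit Types (l : mseries 1 R).

Definition mn1 j : 'X_{1..1} := (U_(ord0) *+ j)%MM.

Lemma mdeg_mn1 j : mdeg (mn1 j) = j.
Proof. by rewrite mdegMn mdeg1 mul1n. Qed.

Lemma mn1E (m : 'X_{1..1}) : m = mn1 (mdeg m).
Proof.
apply/mnmP => i; rewrite mulmnE mnm1E !ord1 eqxx mdegE big_ord1.
by rewrite mul1n.
Qed.

Definition pser n w l (Q : {mpoly R[n]}) := \sum_(j < w) l (mn1 j) *: Q ^+ j.

Lemma mord_pser_sub n w v l (Q Q' : {mpoly R[n]}) :
  mord v (Q - Q') -> mord v (pser w l Q - pser w l Q').
Proof.
move=> QQ; rewrite -sumrB; apply: mord_sum => j _; rewrite -scalerBr.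
exact/mordZ/mord_subX.
Qed.

Lemma approx_pser n w l (Q : {mpoly R[n]}) F :
  approx w Q F -> F 0%MM = 0 -> approx w (pser w l Q) (mcomp l [tuple F]).
Proof.
move=> QF F0; have -> : pser w l Q = pser w l ('X_ord0 : {mpoly R[1]}) \mPo [tuple Q].
  rewrite raddf_sum; apply: eq_bigr => j _ /=.
  by rewrite linearZ /= rmorphXn /= comp_mpolyXU.
apply: approx_mcomp; [|exact: forall_ord1|exact: forall_ord1].
move=> m m_lt; rewrite raddf_sum /= (bigD1 (Ordinal m_lt)) //= mcoeffZ mpolyXn mcoeffX.
rewrite -/(mn1 _) -mn1E eqxx mulr1 big1 ?addr0 // => j jm.
rewrite mcoeffZ mpolyXn mcoeffX; case: eqP => [mE|]; rewrite ?mulr0 //.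
by case/eqP: jm; apply: val_inj; rewrite /= -mE mdeg_mn1.
Qed.

(** Substitution into a series without linear term is a contraction: F^j - G^j with j >= 2 has,
    besides F - G, a factor without constant term. *)
Lemma mcomp1_eq l n w (F G : mseries n R) : F 0%MM = 0 -> G 0%MM = 0 ->
    l (mn1 1) = 0 -> (forall m, (mdeg m < w.+1)%N -> F m = G m) ->
  forall m, (mdeg m < w.+2)%N -> mcomp l [tuple F] m = mcomp l [tuple G] m.
Proof.
move=> F0 G0 l1 FG m m_lt; set v := w.+2 in m_lt *.
have Fv : approx v (mtrunc v F) F by apply: approx_mtrunc.
have Gv : approx v (mtrunc v G) G by apply: approx_mtrunc.
apply/eqP; rewrite -(approx_pser l Fv) // -(approx_pser l Gv) //.
rewrite -subr_eq0 -mcoeffB; apply/eqP.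
suff: mord v (pser v l (mtrunc v F) - pser v l (mtrunc v G)) by apply.
rewrite -sumrB; apply: mord_sum => -[[|[|j]] j_lt] _ /=.
- by rewrite !expr0 subrr; apply: mord0.
- by rewrite l1 !scale0r subrr; apply: mord0.
rewrite -scalerBr; apply: mordZ; apply: (@mordW _ _ _ (w.+1 + j.+1)); first lia.
apply: mord_subXS; last 2 first.
- exact: approx_mord1 Fv F0.
- exact: approx_mord1 Gv G0.
by move=> k k_lt; rewrite mcoeffB !mcoeff_mtrunc; case: ifP; rewrite ?FG ?subrr.
Qed.

Section Invertible.
Variable l : mseries 1 R.
Hypotheses (l0 : l 0%MM = 0) (l1 : l U_(ord0)%MM = 1).

Let lhigh : mseries 1 R := fun m => l m - mserX R ord0 m.

Let mn1_1 : mn1 1 = U_(ord0)%MM.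
Proof. by rewrite /mn1 mulm1n. Qed.

Let lhigh1 : lhigh (mn1 1) = 0.
Proof. by rewrite /lhigh mn1_1 l1 /mserX eqxx subrr. Qed.

Let mcomp_high n (F : mseries n R) m : F 0%MM = 0 ->
  mcomp l [tuple F] m = F m + mcomp lhigh [tuple F] m.
Proof.
move=> F0; have lE : l = mser_add (mserX R ord0) lhigh.
  by apply: funext => k; rewrite /mser_add addrC subrK.
have F0' : forall i, tnth [tuple F] i 0%MM = 0 by apply: forall_ord1.
by rewrite {1}lE mcompD // /mser_add mcompX.
Qed.

Lemma mcomp1_inj n (F G : mseries n R) : F 0%MM = 0 -> G 0%MM = 0 ->
  mcomp l [tuple F] = mcomp l [tuple G] -> F = G.
Proof.
move=> F0 G0 lFG; suff FG w m : (mdeg m < w.+1)%N -> F m = G m.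
  by apply: funext => m; apply: (FG (mdeg m)).
elim: w m => [|w IHw] m m_lt.
  by move: m_lt; rewrite ltnS leqn0 mdeg_eq0 => /eqP->; rewrite F0 G0.
have /(congr1 (fun f => f m)) := lFG; rewrite !mcomp_high //.
by rewrite (mcomp1_eq F0 G0 lhigh1 IHw m_lt) => /addIr.
Qed.

(** The equation reads F = h - (l - X)(F), whose right side is a contraction because l - X has no
    linear term. *)
Lemma mcomp1_solve n (h : mseries n R) : h 0%MM = 0 ->
  exists2 F : mseries n R, F 0%MM = 0 & mcomp l [tuple F] = h.
Proof.
move=> h0; pose step (F : mseries n R) : mseries n R :=
  fun m => h m - mcomp lhigh [tuple F] m.
pose it k := iter k step (mser0 R n).
have lh0 : lhigh 0%MM = 0 by rewrite /lhigh l0 mserX0 subrr.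
have it0 k : it k 0%MM = 0.
  elim: k => [|k IHk] //=; rewrite /step h0 mcomp0 ?lh0 ?subrr //.
  exact: forall_ord1.
have itS k m : (mdeg m < k.+1)%N -> it k m = it k.+1 m.
  elim: k m => [|k IHk] m m_lt.
    by move: m_lt; rewrite ltnS leqn0 mdeg_eq0 => /eqP->; rewrite !it0.
  rewrite /= /step; congr (_ - _).
  exact: (mcomp1_eq (it0 k) (it0 k.+1) lhigh1 IHk).
have itE k m : (mdeg m <= k)%N -> it k m = it (mdeg m) m.
  elim: k => [|k IHk]; first by rewrite leqn0 => /eqP->.
  rewrite leq_eqVlt => /predU1P[->//|m_lt].
  by rewrite -itS // IHk.
(* Diagonal limit: the coefficient at m no longer changes after iterate [mdeg m]. *)
pose F : mseries n R := fun m => it (mdeg m) m; have F0 : F 0%MM = 0 by apply: it0.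
exists F => //; apply: funext => m; rewrite mcomp_high //.
rewrite (@mcomp1_eq lhigh n (mdeg m) F (it (mdeg m)) F0 (it0 _) lhigh1) //.
  rewrite /F itS // /= /step subrK //.
by move=> k; rewrite ltnS /F => /itE.
Qed.
End Invertible.
End Univariate.

(** * Formal group laws and their logarithms *)

Section FormalGroupOfLog.
Variables (R K : comNzRingType) (emb : {rmorphism R -> K}).
Hypothesis emb_inj : injective emb.
Variables (l : mseries 1 K) (F : mseries 2 R).
Hypotheses (lF : is_log emb l F) (F0 : F 0%MM = 0).

Let l0 := log_0 lF.
Let l1 := log_1 lF.

Let embX n (i : 'I_n) : emb \o mserX R i = mserX K i.
Proof. by apply: funext => m /=; rewrite /mserX rmorph_nat. Qed.

Let emb_ext n (f g : mseries n R) : emb \o f = emb \o g :> mseries n K -> f = g.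
Proof.
move=> fg; apply: funext => m; apply: emb_inj.
exact: (congr1 (fun h : mseries n K => h m) fg).
Qed.

Lemma log_mcomp n (A B : mseries n R) : A 0%MM = 0 -> B 0%MM = 0 ->
  mcomp l [tuple (emb \o mcomp F [tuple A; B] : mseries n K)]
    = mser_add (mcomp l [tuple (emb \o A : mseries n K)])
               (mcomp l [tuple (emb \o B : mseries n K)]).
Proof.
move=> A0 B0; pose g := [tuple (emb \o A : mseries n K); (emb \o B : mseries n K)].
have g0 i : tnth g i 0%MM = 0.
  move: i; apply: forall_ord2; first by rewrite (tnth_nth (mser0 K n)) /g /= A0 rmorph0.
  by rewrite (tnth_nth (mser0 K n)) /g inordK //= B0 rmorph0.
have eF0 i : tnth [tuple (emb \o F : mseries 2 K)] i 0%MM = 0.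
  by move: i; apply: forall_ord1; rewrite (tnth_nth (mser0 K 2)) /= F0 rmorph0.
have V0 (j : 'I_2) i : tnth [tuple mserX K j] i 0%MM = 0.
  by move: i; apply: forall_ord1; apply: mserX0.
have -> : emb \o mcomp F [tuple A; B] = mcomp (emb \o F : mseries 2 K) g.
  have gE : map_tuple (fun q : mseries n R => emb \o q : mseries n K) [tuple A; B] = g.
    exact: val_inj.
  by rewrite map_mcomp // gE.
have -> : [tuple mcomp (emb \o F : mseries 2 K) g]
    = map_tuple (fun q => mcomp q g) [tuple (emb \o F : mseries 2 K)].
  exact: val_inj.
rewrite -mcompA // (log_mor lF) mcompD //.
have VE j : map_tuple (fun q => mcomp q g) [tuple mserX K j] = [tuple tnth g j].
  by apply: val_inj => /=; rewrite mcompX.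
rewrite (mcompA l (V0 (inord 0)) g0) (mcompA l (V0 (inord 1)) g0) !VE.
by rewrite !(tnth_nth (mser0 K n)) !inordK.
Qed.

Let log_ext n (A B : mseries n R) : A 0%MM = 0 -> B 0%MM = 0 ->
  mcomp l [tuple (emb \o A : mseries n K)] = mcomp l [tuple (emb \o B : mseries n K)] ->
  A = B.
Proof.
move=> A0 B0 lAB; apply: emb_ext; apply: (mcomp1_inj l1 _ _ lAB) => /=;
  by rewrite ?A0 ?B0 rmorph0.
Qed.

Let mcompF0 n (A B : mseries n R) : A 0%MM = 0 -> B 0%MM = 0 ->
  mcomp F [tuple A; B] 0%MM = 0.
Proof.
move=> A0 B0; rewrite mcomp0 //; apply: forall_ord2; first by rewrite (tnth_nth (mser0 R n)) /= A0.
by rewrite (tnth_nth (mser0 R n)) inordK //= B0.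
Qed.

Let log_ser0 n : mcomp l [tuple (emb \o mser0 R n : mseries n K)] = mser0 K n.
Proof.
have e0 : (emb \o mser0 R n : mseries n K) = mser0 K n.
  by apply: funext => m /=; rewrite rmorph0.
rewrite e0; apply: approx_eq => w; exists 0; split; last exact: approx_0.
have -> : 0 = pser w.+1 l (0 : {mpoly K[n]}).
  rewrite /pser big1 // => -[[|j] j_lt] _ /=; last by rewrite expr0n scaler0.
  by rewrite /mn1 mulm0n l0 scale0r.
by apply: approx_pser => //; apply: approx_0.
Qed.

(** After l is applied, [log_mcomp] turns each axiom into a law of addition of series over K, and l
    can be cancelled by [mcomp1_inj]. *)
Lemma formal_group_of_log : is_formal_group F.
Proof.
have X0 := mserX0 R.
split.
- apply: (log_ext (mcompF0 (X0 _ _) (erefl _)) (X0 _ _)).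
  rewrite (log_mcomp (X0 _ _) (erefl _)) log_ser0.
  by apply: funext => m; apply: addr0.
- apply: (log_ext (mcompF0 (erefl _) (X0 _ _)) (X0 _ _)).
  rewrite (log_mcomp (erefl _) (X0 _ _)) log_ser0.
  by apply: funext => m; apply: add0r.
- apply: (log_ext (mcompF0 (X0 _ _) (X0 _ _)) F0).
  rewrite (log_mcomp (X0 _ _) (X0 _ _)) (log_mor lF) !embX.
  by apply: funext => m; apply: addrC.
have F01 := mcompF0 (X0 3 (inord 0)) (X0 _ (inord 1)).
have F12 := mcompF0 (X0 3 (inord 1)) (X0 _ (inord 2)).
apply: (log_ext (mcompF0 F01 (X0 _ _)) (mcompF0 (X0 _ _) F12)).
apply: etrans (log_mcomp F01 (X0 _ _)) _; apply: etrans (esym (log_mcomp (X0 _ _) F12)).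
have e01 := log_mcomp (X0 3 (inord 0)) (X0 _ (inord 1)).
have e12 := log_mcomp (X0 3 (inord 1)) (X0 _ (inord 2)).
apply: etrans (congr1 (fun h => mser_add h _) e01) _.
apply: etrans (esym (congr1 (mser_add _) e12)).
by apply: funext => m; apply/esym/addrA.
Qed.
End FormalGroupOfLog.

(** Compare constant terms in F(X, 0) = X. *)
Lemma formal_group0 (R : comNzRingType) (F : mseries 2 R) :
  is_formal_group F -> F 0%MM = 0.
Proof.
move=> fgF; have := congr1 (fun f => f 0%MM) (fg_0r fgF).
rewrite mserX0 mcomp0 //; apply: forall_ord2; first by rewrite (tnth_nth (mser0 R 1)) /= mserX0.
by rewrite (tnth_nth (mser0 R 1)) inordK.
Qed.

Lemma log_unique (R K : comNzRingType) (emb : {rmorphism R -> K})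
    (l : mseries 1 K) (F G : mseries 2 R) : injective emb ->
    F 0%MM = 0 -> G 0%MM = 0 -> is_log emb l F -> is_log emb l G -> F = G.
Proof.
move=> emb_inj F0 G0 lF lG.
have FG : emb \o F = emb \o G :> mseries 2 K.
  apply: (mcomp1_inj (log_1 lF)) => /=; rewrite ?F0 ?G0 ?rmorph0 //.
  by rewrite (log_mor lF) (log_mor lG).
apply: funext => m; apply: emb_inj.
exact: (congr1 (fun h : mseries 2 K => h m) FG).
Qed.

Lemma fg_isomorphic_refl (R : comNzRingType) (F : mseries 2 R) :
  is_formal_group F -> fg_isomorphic F F.
Proof.
move=> fgF; have F0 := formal_group0 fgF; have X0 := mserX0 R.
have idX n (f : mseries n R) : f 0%MM = 0 -> mcomp (mserX R ord0) [tuple f] = f.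
  by move=> f0; rewrite mcompX //; apply: forall_ord1.
have hom : is_fg_hom F F (mserX R ord0).
  split=> //; rewrite !idX //.
  have V0 i : tnth [tuple mserX R (inord 0 : 'I_2); mserX R (inord 1 : 'I_2)] i 0%MM = 0.
    move: i; apply: forall_ord2; first by rewrite (tnth_nth (mser0 R 2)) /= X0.
    by rewrite (tnth_nth (mser0 R 2)) inordK //= X0.
  apply: approx_eq => w; exists (mtrunc w.+1 F); split; first exact: approx_mtrunc.
  rewrite -{1}[mtrunc _ _]comp_mpoly_id; apply: approx_mcomp => //.
    exact: approx_mtrunc.
  move=> i; rewrite tnth_mktuple (tnth_nth (mser0 R 2)).
  have -> : nth (mser0 R 2) [:: mserX R (inord 0 : 'I_2); mserX R (inord 1 : 'I_2)] i
          = mserX R i.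
    by case: i => [[|[|//]] lt_i] /=; congr mserX; apply: val_inj; rewrite /= inordK.
  exact: approx_X.
by exists (mserX R ord0), (mserX R ord0); split; rewrite ?idX.
Qed.

(** * The functional equation argument *)

Section PrimePowers.
Variables (p : nat) (p_pr : prime p) (S : comNzRingType).
Implicit Types x y : S.

(** The inner binomials are divisible by p. The factor x y is kept for [congr_expr_prime]: if one
    summand is divisible by p^(j+1), the mixed term is divisible by p^(j+2). *)
Lemma exprD_prime x y :
  exists z, (x + y) ^+ p = x ^+ p + y ^+ p + p%:R * (x * y * z).
Proof.
have p2 := prime_gt1 p_pr.
have [q pE] : exists q, p = q.+2 by case: p p2 => [|[|q]] // _; exists q.
rewrite exprDn pE big_ord_recl big_ord_recr /= subn0 expr0 mulr1 subnn expr0 mul1r.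
rewrite bin0 binn !mulr1n -pE.
exists (\sum_(i < q.+1) (x ^+ (q - i) * y ^+ i) *+ ('C(p, i.+1) %/ p)).
rewrite [RHS]addrAC -[RHS]addrA; congr (_ + (_ + _)); last by rewrite pE.
rewrite mulrA !big_distrr /=; apply: eq_bigr => i _; rewrite /bump /= add1n.
have i_lt := ltn_ord i.
have p_dvd : (p %| 'C(p, i.+1))%N by apply: prime_dvd_bin => //; rewrite pE; lia.
have -> : (p - i.+1 = (q - i).+1)%N by rewrite pE; lia.
rewrite -[LHS]mulr_natr -[(_ * _) *+ _]mulr_natr -{1}(divnK p_dvd) natrM !exprS.
by ring.
Qed.

Lemma congr_expr_prime j x y z :
  x = y + p%:R ^+ j.+1 * z -> exists t, x ^+ p = y ^+ p + p%:R ^+ j.+2 * t.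
Proof.
move=> ->; have [t ->] := exprD_prime y (p%:R ^+ j.+1 * z).
have [q pE] : exists q, p = q.+2.
  by case: p (prime_gt1 p_pr) => [|[|q]] // _; exists q.
exists (p%:R ^+ j * p%:R ^+ (j.+1 * q) * z ^+ p + y * z * t).
rewrite exprMn -exprM {3}pE; have -> : (j.+1 * q.+2 = j.+2 + j + j.+1 * q)%N by lia.
by rewrite !exprD !exprS; ring.
Qed.

Lemma congr_expr_prime_pow x y z k : x = y + p%:R * z ->
  exists t, x ^+ (p ^ k) = y ^+ (p ^ k) + p%:R ^+ k.+1 * t.
Proof.
move=> xy; elim: k => [|k [t IHk]]; first by exists z; rewrite expn0 !expr1.
by rewrite expnSr !exprM; apply: congr_expr_prime IHk.
Qed.
End PrimePowers.

(** Modulo p the p-th power is additive and, by [fermat], fixes the coefficients, so it acts on the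
    variables alone. *)
Lemma mpoly_expr_prime p (p_pr : prime p) (S : comNzRingType) n (P : {mpoly S[n]}) :
    (forall x : S, exists z, x ^+ p = x + p%:R * z) ->
  exists C, P ^+ p = (P \mPo [tuple 'X_i ^+ p | i < n]) + p%:R * C.
Proof.
move=> fermat; elim/mpolyind: P => [|c m P _ _ [C IH]].
  by exists 0; rewrite comp_mpoly0 expr0n mulr0 addr0 gtn_eqF ?prime_gt0.
have [t ->] := exprD_prime p_pr (c *: 'X_[m]) P.
have [z cE] := fermat c.
exists (z *: 'X_[m] ^+ p + C + c *: 'X_[m] * P * t).
rewrite IH raddfD /= linearZ /= exprZn cE comp_mpolyX.
have -> : \prod_i tnth [tuple 'X_i ^+ p | i < n] i ^+ m i = 'X_[m] ^+ p :> {mpoly S[n]}.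
  rewrite mpolyXE_id -prodrXl; apply: eq_bigr => i _.
  by rewrite tnth_mktuple -!exprM mulnC.
by rewrite scalerDl -scalerA scaler_nat -[_ *+ p]mulr_natl; ring.
Qed.

(** * The embedding of Z_p in Q_p, and Fermat's congruence *)

Section PadicEmbedding.
Variables (p : nat) (p_pr : prime p).
Local Notation Zp := (padic_int p_pr).
Local Notation Qp := (padic p_pr).

Fact padic_of_int_zmod : zmod_morphism (@padic_of_int p p_pr).
Proof. exact: tofracB. Qed.
Fact padic_of_int_monoid : monoid_morphism (@padic_of_int p p_pr).
Proof. by split; [exact: tofrac1 | exact: tofracM]. Qed.
HB.instance Definition _ :=
  GRing.isZmodMorphism.Build Zp Qp (@padic_of_int p p_pr) padic_of_int_zmod.
HB.instance Definition _ :=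
  GRing.isMonoidMorphism.Build Zp Qp (@padic_of_int p p_pr) padic_of_int_monoid.

Lemma padic_of_int_inj : injective (@padic_of_int p p_pr).
Proof. by move=> x y /eqP; rewrite tofrac_eq => /eqP. Qed.

(** As n < p^n, the residue of n modulo p^n is n itself. *)
Lemma padic_natr_neq0 n : (0 < n)%N -> n%:R != 0 :> Qp.
Proof.
move=> n_gt0; have -> : n%:R = padic_of_int (n%:R : Zp) :> Qp by rewrite rmorph_nat.
rewrite tofrac_eq0; apply/eqP => n0.
have := pres_nat p_pr n n; rewrite n0.
have -> : pres (0 : Zp) n = 0 by exact: mod0z.
rewrite modz_nat.
rewrite (modn_small (ltn_expl n (prime_gt1 p_pr))).
by move=> [n0']; rewrite -n0' in n_gt0.
Qed.

Lemma padic_expr_prime (x : Zp) : exists z, x ^+ p = x + p%:R * z.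
Proof.
have nat_case m : exists z : Zp, m%:R ^+ p = m%:R + p%:R * z.
  elim: m => [|m [z IHm]].
    by exists 0; rewrite expr0n mulr0 addr0 gtn_eqF ?prime_gt0.
  have [t E] := exprD_prime p_pr (m%:R : Zp) 1.
  by exists (z + m%:R * 1 * t); rewrite -addn1 natrD E IHm expr1n; ring.
(* Fermat's congruence passes from the natural number representing x modulo p to x itself. *)
have [y xE] : exists y, x - `|pres x 1|%:R = p%:R ^+ 1 * y.
  apply: pres_eq0_dvd; rewrite /= pres_nat.
  have x_ge0 : 0 <= pres x 1.
    rewrite -presK modz_ge0 // expn1 -lt0n prime_gt0 //.
  by rewrite gez0_abs // modzNm modzDmr subrr mod0z.
have [z E] := nat_case `|pres x 1|%N.
have /(congr_expr_prime_pow p_pr 1)[t] : x = `|pres x 1|%:R + p%:R * y.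
  by rewrite -[LHS](subrK `|pres x 1|%:R) xE addrC.
rewrite expn1 => ->; exists (z + p%:R * t - y); rewrite E.
rewrite -[x in RHS](subrK `|pres x 1|%:R) xE expr1.
by rewrite expr2; ring.
Qed.

End PadicEmbedding.

Lemma big_nat_dvd (V : nmodType) q w (F : nat -> V) : (0 < q)%N ->
  \sum_(0 <= j < q * w | (q %| j)%N) F j = \sum_(0 <= i < w) F (q * i)%N.
Proof.
move=> q_gt0; elim: w => [|w IHw]; first by rewrite muln0 !big_geq.
rewrite big_nat_recr //= -IHw (@big_cat_nat _ _ _ (q * w)) ?leq_mul //=.
congr (_ + _); have lt_q : (q * w < q * w.+1)%N by rewrite mulnS; lia.
rewrite big_ltn_cond // dvdn_mulr // big_nat_cond big1 ?addr0 // => j.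
case/andP=> /andP[j1 j2] /dvdnP[i jE]; move: j1 j2; rewrite jE [(i * q)%N]mulnC.
by rewrite !ltn_pmul2l // => i1 i2; lia.
Qed.

Section PserTheory.
Variables (K : comNzRingType) (n : nat).
Implicit Types (l g : mseries 1 K) (Q : {mpoly K[n]}).

Lemma pserD w l g Q : pser w (mser_add l g) Q = pser w l Q + pser w g Q.
Proof. by rewrite -big_split /=; apply: eq_bigr => j _; rewrite scalerDl. Qed.

Lemma pser_X w Q : (1 < w)%N -> pser w (mserX K ord0) Q = Q.
Proof.
move=> w_gt1; have X1 j : mserX K ord0 (mn1 j) = (j == 1%N)%:R.
  rewrite /mserX; congr (_%:R); congr nat_of_bool.
  have -> : U_(ord0)%MM = mn1 1 by rewrite /mn1 mulm1n.
  by apply/eqP/eqP => [/(congr1 (@mdeg 1))|->//]; rewrite !mdeg_mn1.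
rewrite /pser (bigD1 (Ordinal w_gt1)) //= X1 eqxx scale1r expr1 big1 ?addr0 //.
by move=> j jn; rewrite X1 (negPf (jn : (j != 1 :> nat)%N)) scale0r.
Qed.

Lemma comp_pser r w l (P : {mpoly K[r]}) (q : r.-tuple {mpoly K[n]}) :
  pser w l P \mPo q = pser w l (P \mPo q).
Proof.
rewrite raddf_sum; apply: eq_bigr => j _ /=.
by rewrite linearZ /= rmorphXn.
Qed.

Lemma mord_pser_high w v l Q Q' : mord v (Q - Q') -> mord 1 Q -> mord 1 Q' ->
  l (mn1 1) = 0 -> mord v.+1 (pser w l Q - pser w l Q').
Proof.
move=> QQ Q1 Q1' l1; rewrite -sumrB; apply: mord_sum => -[[|[|j]] j_lt] _ /=.
- by rewrite !expr0 subrr; apply: mord0.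
- by rewrite l1 !scale0r subrr; apply: mord0.
rewrite -scalerBr; apply: mordZ; apply: (@mordW _ _ _ (v + j.+1)); first lia.
exact: mord_subXS.
Qed.

(** The hypothesis says l(X) = g(X) + rho l(X^p). For truncations this holds only up to order w,
    because l(Q^p) cut at w still contains powers Q^j with w <= j < p w. *)
Lemma pser_functional p w l g (rho : K) Q : (0 < p)%N -> mord 1 Q ->
    (forall j, l (mn1 j) = g (mn1 j) + (if (p %| j)%N then rho * l (mn1 (j %/ p)) else 0)) ->
  mord w (pser w l Q - (pser w g Q + rho *: pser w l (Q ^+ p))).
Proof.
move=> p_gt0 Q1 lE.
have Qpow j : mord j (Q ^+ j) by rewrite -[X in mord X _]mul1n; apply: mordX.
pose F j := (rho * l (mn1 (j %/ p))) *: Q ^+ j.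
have -> : rho *: pser w l (Q ^+ p) = \sum_(0 <= j < p * w | (p %| j)%N) F j.
  rewrite big_nat_dvd // big_mkord scaler_sumr; apply: eq_bigr => j _.
  by rewrite /F mulKn // scalerA exprM.
have -> : pser w l Q = pser w g Q + \sum_(0 <= j < w | (p %| j)%N) F j.
  rewrite big_mkcond big_mkord -big_split /=; apply: eq_bigr => j _.
  by rewrite lE scalerDl; case: ifP => //; rewrite scale0r.
rewrite opprD addrACA subrr add0r.
have le_w : (w <= p * w)%N by apply: leq_pmull.
rewrite (@big_cat_nat _ _ _ w 0 (p * w)) //= opprD addrA subrr add0r.
apply: mordN; rewrite big_nat_cond; apply: mord_sum => j /andP[/andP[j_ge _] _].
by apply: mordZ; apply: mordW j_ge _; apply: Qpow.
Qed.
End PserTheory.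

Lemma functional_coef (K : fieldType) (x q r c z : K) : x != 0 -> q != 0 ->
  (r * c + x * q * z) / (x * q) - r / x * (c / q) = z.
Proof. by move=> x0 q0; field; rewrite ?x0 ?q0. Qed.

Lemma functional_cancel (K : fieldType) (x q r c : K) : x != 0 -> q != 0 ->
  r / x * (c / q) * (x * q) = r * c.
Proof. by move=> x0 q0; field; rewrite ?x0 ?q0. Qed.

Section FunctionalEquation.
Variables (R : comNzRingType) (K : fieldType) (emb : {rmorphism R -> K}).
Hypothesis emb_inj : injective emb.

Definition integral_mpoly n (P : {mpoly K[n]}) :=
  exists P' : {mpoly R[n]}, P = map_mpoly emb P'.

Lemma integral_mpolyD n (P Q : {mpoly K[n]}) :
  integral_mpoly P -> integral_mpoly Q -> integral_mpoly (P + Q).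
Proof. by move=> [P' ->] [Q' ->]; exists (P' + Q'); rewrite raddfD. Qed.

Lemma integral_mpolyB n (P Q : {mpoly K[n]}) :
  integral_mpoly P -> integral_mpoly Q -> integral_mpoly (P - Q).
Proof. by move=> [P' ->] [Q' ->]; exists (P' - Q'); rewrite raddfB. Qed.

Lemma integral_mpoly_sum n (I : Type) (r : seq I) (A : pred I) (F : I -> {mpoly K[n]}) :
  (forall i, A i -> integral_mpoly (F i)) -> integral_mpoly (\sum_(i <- r | A i) F i).
Proof.
move=> Fi; apply: big_ind => //; last exact: integral_mpolyD.
by exists 0; rewrite raddf0.
Qed.

Lemma integral_mpolyZ n z (P : {mpoly K[n]}) :
  integral_mpoly P -> integral_mpoly (emb z *: P).
Proof. by move=> [P' ->]; exists (z *: P'); rewrite map_mpolyZ. Qed.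

Lemma integral_mpolyX n (P : {mpoly K[n]}) k :
  integral_mpoly P -> integral_mpoly (P ^+ k).
Proof. by move=> [P' ->]; exists (P' ^+ k); rewrite rmorphXn. Qed.

Lemma integral_pser n w (l : mseries 1 K) (Q : {mpoly K[n]}) :
  (forall m, exists z, l m = emb z) -> integral_mpoly Q -> integral_mpoly (pser w l Q).
Proof.
move=> lz Qi; apply: integral_mpoly_sum => j _; have [z ->] := lz (mn1 j).
exact/integral_mpolyZ/integral_mpolyX.
Qed.

Lemma integral_mtrunc n w (F : mseries n K) :
    (forall m, (mdeg m < w)%N -> exists z, F m = emb z) ->
  integral_mpoly (mtrunc w F).
Proof.
move=> Fz; apply: integral_mpoly_sum => m _; have [z ->] := Fz m (bmdeg m).
by apply: integral_mpolyZ; exists 'X_[m]; rewrite map_mpolyX.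
Qed.

Variables (p : nat) (p_pr : prime p).
Hypothesis pK : p%:R != 0 :> K.
Hypothesis fermat : forall x : R, exists z, x ^+ p = x + p%:R * z.
Variables (c : nat -> R) (r : R) (l : mseries 1 K).
Hypothesis c0 : c 0%N = 1.
Hypothesis cS : forall k, exists z, c k.+1 - r * c k = p%:R ^+ k.+1 * z.
Hypothesis l_pow : forall k, l (mn1 (p ^ k)) = emb (c k) / p%:R ^+ k.
Hypothesis l_out : forall j, (forall k, j != (p ^ k)%N) -> l (mn1 j) = 0.

Let p_gt0 := prime_gt0 p_pr.

Let l_spec j : (exists k, j = (p ^ k)%N) \/
  (l (mn1 j) = 0 /\ forall k, j != (p ^ k)%N).
Proof.
have [[k jE]|jN] := pselect (exists k, j = (p ^ k)%N); first by left; exists k.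
have jn k : j != (p ^ k)%N by apply/eqP => jE; apply: jN; exists k.
by right; split=> //; apply: l_out.
Qed.

Let rho : K := emb r / p%:R.
Let g : mseries 1 K := fun m =>
  l m - (if (p %| mdeg m)%N then rho * l (mn1 (mdeg m %/ p)) else 0).

Let gE j : l (mn1 j) = g (mn1 j) + (if (p %| j)%N then rho * l (mn1 (j %/ p)) else 0).
Proof. by rewrite /g mdeg_mn1 subrK. Qed.

Let g1 : g (mn1 1) = 1.
Proof.
rewrite /g mdeg_mn1 dvdn1 gtn_eqF ?prime_gt1 // subr0.
by have := l_pow 0; rewrite expn0 c0 rmorph1 expr0 divr1.
Qed.

(** At p^(k+1) the coefficient is (c_(k+1) - r c_k) / p^(k+1), which [cS] makes integral. If j is
    not a power of p, neither is j/p, so both terms vanish. *)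
Let g_int m : exists z, g m = emb z.
Proof.
rewrite (mn1E m) /g mdeg_mn1; have [[k ->]|[-> jE]] := l_spec (mdeg m).
  rewrite l_pow; case: k => [|k].
    exists 1; rewrite expn0 dvdn1 gtn_eqF ?prime_gt1 // subr0.
    by rewrite c0 expr0 divr1.
  rewrite expnS mulKn // dvdn_mulr // l_pow; have [z cz] := cS k.
  exists z; have -> : emb (c k.+1) = emb r * emb (c k) + p%:R ^+ k.+1 * emb z.
    have -> : p%:R = emb p%:R by rewrite rmorph_nat.
    by rewrite -rmorphXn -!rmorphM -rmorphD -cz addrC subrK.
  by rewrite exprS functional_coef // expf_neq0.
exists 0; rewrite rmorph0; case: ifP => p_dvd; last by rewrite subr0.
have [[k kE]|[-> _]] := l_spec (mdeg m %/ p).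
  by have /eqP[] := jE k.+1; rewrite expnSr -kE divnK.
by rewrite mulr0 subr0.
Qed.

(* [l_(p^k) = c_k / p^k] while [A^(p^k) = B^(p^k)] modulo [p^(k+1)]. *)
Let integral_pser_sub n w (A B : {mpoly R[n]}) C : A = B + p%:R * C ->
  integral_mpoly (rho *: (pser w l (map_mpoly emb A) - pser w l (map_mpoly emb B))).
Proof.
move=> AB; rewrite -sumrB scaler_sumr; apply: integral_mpoly_sum => j _.
have [[k ->]|[-> _]] := l_spec j; last first.
  by rewrite !scale0r subrr scaler0; exists 0; rewrite raddf0.
have [D ABD] := congr_expr_prime_pow p_pr k AB.
rewrite -scalerBr -!rmorphXn -rmorphB /= ABD [_ + _ * D]addrC addrK l_pow.
exists ((r * c k) *: D); rewrite map_mpolyZ.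
have -> : map_mpoly emb (p%:R ^+ k.+1 * D) = p%:R ^+ k.+1 * map_mpoly emb D.
  by rewrite rmorphM rmorphXn rmorph_nat.
rewrite scalerA -(scaler_nat p (1 : {mpoly K[n]})) exprZn expr1n.
rewrite -scalerAl mul1r scalerA rmorphM; congr (_ *: _).
by rewrite /rho exprS functional_cancel // expf_neq0.
Qed.

(** Used for [GPT], where every parenthesis on the right has order w. LPX and LAX stand for l at P^p
    and A^p, while LPP and LAP stand for l at P and A with the variables raised to the power p. *)
Let telescope (S : comNzRingType) (GP GX GY LP LX LY PX PY LPX LAX LPP LAP a : S) :
  GP - (GX + GY + a * (LAP - LAX)) =
    - (LP - (GP + a * LPX)) + (LP - (LX + LY)) + (LX - (GX + a * PX))
    + (LY - (GY + a * PY)) - a * (LPP - (PX + PY)) - a * (LAP - LPP)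
    + a * (LAX - LPX).
Proof. by ring. Qed.

Let telescope_high (S : comNzRingType) (P T hP hA : S) :
  P - (T - hA) = (P + hP - T) - (hP - hA).
Proof. by ring. Qed.

Section Integrality.
Variable F : mseries 2 K.
Hypothesis F0 : F 0%MM = 0.
Hypothesis lF : mcomp l [tuple F] = mser_add (mcomp l [tuple mserX K (inord 0)])
                                             (mcomp l [tuple mserX K (inord 1)]).

(** Let A and P be the parts of F of degree < n and <= n. The functional equation turns l(P) = l(X)
    + l(Y) into g(P) = g(X) + g(Y) + (r/p) (l(P(X^p, Y^p)) - l(P^p)) up to order n + 1. On the right
    P may be replaced by the integral A, and [integral_pser_sub] applies. Since g - X has no linear
    term, P equals g(P) - (g - X)(A) up to order n + 1. *)
Let integral_step n : (0 < n)%N ->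
    (forall m, (mdeg m < n)%N -> exists z, F m = emb z) ->
  forall m, (mdeg m < n.+1)%N -> exists z, F m = emb z.
Proof.
move=> n_gt0 IH; pose w := n.+1.
pose P := mtrunc w F; pose A := mtrunc n F.
have PF : approx w P F by apply: approx_mtrunc.
have P1 : mord 1 P by apply: approx_mord1 PF F0.
have A1 : mord 1 A by apply: approx_mord1 (@approx_mtrunc _ _ _ _) F0.
have PA : mord n (P - A).
  apply/(@approxP _ _ _ _ _ F); last exact: approx_mtrunc.
  by move=> m m_lt; apply: PF; apply: ltnW.
pose X i : {mpoly K[2]} := 'X_(inord i).
have X1 i : mord 1 (X i).
  by apply: (approx_mord1 (w := 1)) (@approx_X _ _ _ _) _; rewrite ?mserX0.
pose L := pser w l : {mpoly K[2]} -> {mpoly K[2]}.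
pose G := pser w g : {mpoly K[2]} -> {mpoly K[2]}.
have LE Q : mord 1 Q -> mord w (L Q - (G Q + rho *: L (Q ^+ p))).
  by move=> Q1; apply: pser_functional.
have LP : mord w (L P - (L (X 0%N) + L (X 1%N))).
  have LX i : approx w (L (X i)) (mcomp l [tuple mserX K (inord i)]).
    by apply: approx_pser; [apply: approx_X | rewrite mserX0].
  apply/(@approxP _ _ _ _ _ (mcomp l [tuple F])); first exact: approx_pser.
  by rewrite lF; apply: approxD.
pose xp : 2.-tuple {mpoly K[2]} := [tuple 'X_i ^+ p | i < 2].
have xp_ord i : mord p (tnth xp i).
  rewrite tnth_mktuple -[X in mord X _]mul1n; apply: mordX.
  by apply: (approx_mord1 (w := 1)) (@approx_X _ _ _ _) _; rewrite ?mserX0.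
(* The relation [LP] with both variables raised to the power p. *)
have LPp : mord w (L (P \mPo xp) - (L (X 0%N ^+ p) + L (X 1%N ^+ p))).
  have Xxp i : X i \mPo xp = X i ^+ p by rewrite comp_mpolyXU -tnth_nth tnth_mktuple.
  have LC Q : L Q \mPo xp = L (Q \mPo xp) by apply: comp_pser.
  rewrite -!Xxp -!LC -comp_mpolyD -comp_mpolyB; apply: comp_mord LP => i.
  by apply: mordW (xp_ord i).
(* P - A has order n, hence order p n >= n + 1 once the variables are raised to the power p. *)
have APp : mord w (L (A \mPo xp) - L (P \mPo xp)).
  apply: mord_pser_sub; rewrite -raddfB /=.
  apply: (@mordW _ _ _ (p * n)); first by have := prime_gt1 p_pr; rewrite /w; nia.
  by apply: comp_mordM => //; apply: mord_sym.
(* Here the gain of p - 1 degrees comes from the cofactor of P - A in P^p - A^p. *)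
have APX : mord w (L (A ^+ p) - L (P ^+ p)).
  apply: mord_pser_sub; apply: mord_sym.
  have pE : p = p.-2.+2 by case: p (prime_gt1 p_pr) => [|[|]].
  rewrite pE; apply: (@mordW _ _ _ (n + p.-2.+1)); first by rewrite /w; lia.
  exact: mord_subXS.
have [A' AE] := integral_mtrunc IH; rewrite -/A in AE.
pose T := G (X 0%N) + G (X 1%N) + rho *: (L (A \mPo xp) - L (A ^+ p)).
have GPT : mord w (G P - T).
  have -> : G P - T = - (L P - (G P + rho *: L (P ^+ p)))
    + (L P - (L (X 0%N) + L (X 1%N)))
    + (L (X 0%N) - (G (X 0%N) + rho *: L (X 0%N ^+ p)))
    + (L (X 1%N) - (G (X 1%N) + rho *: L (X 1%N ^+ p)))
    - rho *: (L (P \mPo xp) - (L (X 0%N ^+ p) + L (X 1%N ^+ p)))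
    - rho *: (L (A \mPo xp) - L (P \mPo xp))
    + rho *: (L (A ^+ p) - L (P ^+ p)).
    rewrite /T; move: (G P) (G (X 0%N)) (G (X 1%N)) (L P) (L (X 0%N)) (L (X 1%N))
      (L (X 0%N ^+ p)) (L (X 1%N ^+ p)) (L (P ^+ p)) (L (A ^+ p))
      (L (P \mPo xp)) (L (A \mPo xp)) => GP GX GY LP' LX LY PX PY LPX LAX LPP LAP.
    by rewrite -!mul_mpolyC; apply: telescope.
  apply: mordD; last exact: mordZ.
  apply: mordB; last exact: mordZ.
  apply: mordB; last exact: mordZ.
  apply: mordD; last exact: LE.
  apply: mordD; last exact: LE.
  by apply: mordD => //; apply/mordN/LE.
have Ti : integral_mpoly T.
  have Xi i : integral_mpoly (X i) by exists 'X_(inord i); rewrite map_mpolyX.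
  apply: integral_mpolyD; first by apply: integral_mpolyD; apply: integral_pser.
  have [C AC] := mpoly_expr_prime p_pr A' fermat.
  have -> : A \mPo xp = map_mpoly emb (A' \mPo [tuple 'X_i ^+ p | i < 2]).
    rewrite (map_mpoly_comp _ _ (emb_inj)) -AE.
    congr (_ \mPo _); apply: eq_from_tnth => i.
    by rewrite tnth_map !tnth_mktuple rmorphXn /= map_mpolyX.
  have -> : A ^+ p = map_mpoly emb (A' ^+ p) by rewrite rmorphXn /= AE.
  by apply: (@integral_pser_sub _ _ _ _ (- C)); rewrite AC mulrN addrK.
pose gh : mseries 1 K := fun m => g m - mserX K ord0 m.
have gh1 : gh (mn1 1) = 0 by rewrite /gh g1 /mn1 mulm1n /mserX eqxx subrr.
have ghE Q : G Q = Q + pser w gh Q.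
  have -> : Q + pser w gh Q = pser w (mserX K ord0) Q + pser w gh Q.
    by rewrite pser_X.
  by rewrite -pserD; apply: eq_bigr => j _; rewrite /mser_add /gh addrC subrK.
have gh_int m : exists z, gh m = emb z.
  have [z gz] := g_int m; exists (z - (m == U_(ord0)%MM)%:R).
  by rewrite rmorphB rmorph_nat /gh gz.
have Si : integral_mpoly (T - pser w gh A).
  by apply: integral_mpolyB => //; apply: integral_pser => //; exists A'.
have PS : mord w (P - (T - pser w gh A)).
  have -> : P - (T - pser w gh A) = (G P - T) - (pser w gh P - pser w gh A).
    by rewrite ghE; apply: telescope_high.
  by apply: mordB GPT _; apply: mord_pser_high PA P1 A1 gh1.
move=> m m_lt; have [S' SE] := Si; exists (S'@_m).
rewrite -PF // -mcoeff_map_mpoly -SE; apply/eqP.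
by rewrite -subr_eq0 -mcoeffB PS.
Qed.

Lemma integral_log_sum m : exists z, F m = emb z.
Proof.
suff FI n : forall m, (mdeg m < n.+1)%N -> exists z, F m = emb z.
  exact: (FI (mdeg m)).
elim: n => [|n IHn]; last exact: integral_step.
move=> k; rewrite ltnS leqn0 mdeg_eq0 => /eqP->; exists 0.
by rewrite F0 rmorph0.
Qed.
End Integrality.

(** Hazewinkel's functional equation lemma; there is no Frobenius twist because [fermat] makes
    Frobenius trivial on R modulo p. *)
Lemma formal_group_functional :
  exists2 F : mseries 2 R, is_formal_group F & is_log emb l F.
Proof.
have mn1_1 : mn1 1 = U_(ord0)%MM by rewrite /mn1 mulm1n.
have l0 : l 0%MM = 0.
  have <- : mn1 0 = 0%MM by rewrite /mn1 mulm0n.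
  by apply: l_out => k; rewrite ltn_eqF // expn_gt0 p_gt0.
have l1 : l U_(ord0)%MM = 1.
  by have := l_pow 0; rewrite expn0 mn1_1 c0 rmorph1 expr0 divr1.
pose h := mser_add (mcomp l [tuple mserX K (inord 0 : 'I_2)])
                   (mcomp l [tuple mserX K (inord 1 : 'I_2)]).
have h0 : h 0%MM = 0.
  rewrite /h /mser_add !mcomp0 ?l0 ?addr0 //; apply: forall_ord1; exact: mserX0.
have [F F0 lF] := mcomp1_solve l0 l1 h0.
have [F' F'E] := choice (integral_log_sum F0 lF).
have FE : emb \o F' = F by apply: funext => m /=; rewrite F'E.
have F'0 : F' 0%MM = 0.
  by apply: emb_inj; rewrite rmorph0 -F'E.
have logF : is_log emb l F' by split=> //; rewrite FE.
by exists F' => //; apply: formal_group_of_log logF F'0; apply: emb_inj.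
Qed.
End FunctionalEquation.

Section PtypicalLog.
Variables (p : nat) (p_pr : prime p) (c : nat -> padic_int p_pr).

Lemma formal_group_ptypical (r : padic_int p_pr) : c 0%N = 1 ->
    (forall k, exists z, c k.+1 - r * c k = p%:R ^+ k.+1 * z) ->
  exists2 F : mseries 2 (padic_int p_pr),
    is_formal_group F & is_log (@padic_of_int p p_pr) (ptypical_series c) F.
Proof.
move=> c0 cS.
apply: (formal_group_functional (emb := @padic_of_int p p_pr)
  (@padic_of_int_inj p p_pr) p_pr _ (@padic_expr_prime p p_pr) c0 cS).
- exact/padic_natr_neq0/prime_gt0.
- by move=> k; rewrite /ptypical_series mdeg_mn1 pfactorK // eqxx.
by move=> j jE; rewrite /ptypical_series mdeg_mn1 (negPf (jE _)).
Qed.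
End PtypicalLog.

(** * Laurent series *)

Section PowserTheory.
Variable k : fieldType.
Implicit Types f g h : powser k.

Lemma pcoef0_mul f g : pcoef (f * g) 0 = pcoef f 0 * pcoef g 0.
Proof. by rewrite /= big_ord1. Qed.

Lemma pcoefX_mulS f n : pcoef (powserX k * f) n.+1 = pcoef f n.
Proof.
rewrite /= big_ord_recl /= mul0r add0r big_ord_recl /= mul1r subn1 big1 ?addr0 //.
by move=> i _; rewrite mul0r.
Qed.

Lemma pcoefX_mul0 f : pcoef (powserX k * f) 0 = 0.
Proof. by rewrite pcoef0_mul mul0r. Qed.

Lemma powser_mulX f : pcoef f 0 = 0 -> exists g, f = powserX k * g.
Proof.
move=> f0; exists (Powser (fun n => pcoef f n.+1)).
by apply: powser_ext => -[|n]; rewrite ?pcoefX_mul0 ?pcoefX_mulS.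
Qed.

Lemma powser_decomp f : exists g, f = powser_cst (pcoef f 0) + powserX k * g.
Proof.
have [|g fE] := @powser_mulX (f - powser_cst (pcoef f 0)).
  by rewrite /= subrr.
by exists g; rewrite -fE addrC subrK.
Qed.

Lemma powser_order f : f != 0 ->
  exists n g, pcoef g 0 != 0 /\ f = powserX k ^+ n * g.
Proof.
move=> f0; have [m fm] : exists m, pcoef f m != 0.
  apply: contra_neqP f0 => /forallNP f0; apply: powser_ext => n.
  by have /negP := f0 n; rewrite negbK => /eqP->; case: n.
elim: m f {f0} fm => [|m IHm] f fm; first by exists 0%N, f; rewrite mul1r.
have [f0|f0] := eqVneq (pcoef f 0) 0; last by exists 0%N, f; rewrite mul1r.
have [g fE] := powser_mulX f0.
have [|n [h [h0 gE]]] := IHm g; first by rewrite -pcoefX_mulS -fE.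
by exists n.+1, h; rewrite exprS -mulrA -gE.
Qed.

Definition peq n f g := forall i, (i < n)%N -> pcoef f i = pcoef g i.

Lemma peqMX n f g : peq n f g -> peq n.+1 (powserX k * f) (powserX k * g).
Proof. by move=> fg [|i] lt_i; rewrite ?pcoefX_mul0 // !pcoefX_mulS fg. Qed.

Lemma peqM n f g f' g' : peq n f f' -> peq n g g' -> peq n (f * g) (f' * g').
Proof.
move=> ff gg i lt_i /=; apply: eq_bigr => -[j lt_j] _ /=.
rewrite (ff j); last by apply: leq_ltn_trans lt_i; rewrite -ltnS.
by rewrite (gg (i - j)%N) //; apply: leq_ltn_trans lt_i; apply: leq_subr.
Qed.

Lemma peqD n f g f' g' : peq n f f' -> peq n g g' -> peq n (f + g) (f' + g').
Proof. by move=> ff gg i lt_i /=; rewrite ff ?gg. Qed.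

Lemma peqN n f f' : peq n f f' -> peq n (- f) (- f').
Proof. by move=> ff i lt_i /=; rewrite ff. Qed.

Lemma peq_exp n f f' m : peq n f f' -> peq n (f ^+ m) (f' ^+ m).
Proof. by move=> ff; elim: m => [|m IHm]; [|rewrite !exprS; apply: peqM]. Qed.

(** Iteration from 0 converges coefficientwise. This provides both inverses of series and the
    expansion of 1/x on the curve. *)
Lemma powser_fix (Phi : powser k -> powser k) :
  (forall n f g, peq n f g -> peq n.+1 (Phi f) (Phi g)) -> exists f, Phi f = f.
Proof.
move=> PhiP; pose it n := iter n Phi 0.
have itS n : peq n (it n) (it n.+1) by elim: n => // n IHn; apply: PhiP.
have itE n m : (n < m)%N -> pcoef (it m) n = pcoef (it n.+1) n.
  elim: m => // m IHm; rewrite ltnS leq_eqVlt => /predU1P[->//|lt_nm].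
  by rewrite -itS // IHm.
exists (Powser (fun n => pcoef (it n.+1) n)); apply: powser_ext => n /=.
apply: (PhiP n) => // i lt_i /=; symmetry.
exact: itE.
Qed.

Lemma powser_inv f : pcoef f 0 != 0 -> exists g, f * g = 1.
Proof.
move=> f0; have [h fE] := powser_decomp f; set c := pcoef f 0 in f0 fE.
(* With f = c + X h, the equation f g = 1 reads g = c^-1 (1 - X h g). *)
have [|g gE] := @powser_fix (fun g => powser_cst c^-1 * (1 - powserX k * (h * g))).
  move=> n g g' gg; apply: peqM => //; apply: peqD => //; apply: peqN.
  by apply: peqMX; apply: peqM.
exists g; rewrite fE mulrDl -mulrA -{1}gE mulrA.
have -> : powser_cst c * powser_cst c^-1 = 1.
  apply: powser_ext => -[|i]; first by rewrite pcoef0_mul /= mulfV.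
  by rewrite /= big1 // => -[[|j] lt_j] _ /=; rewrite ?mulr0 // mul0r.
by rewrite mul1r subrK.
Qed.

Lemma powser_cst_zmod : zmod_morphism (@powser_cst k).
Proof. by move=> x y; apply: powser_ext => -[|n] //=; rewrite subr0. Qed.

Lemma powser_cst_monoid : monoid_morphism (@powser_cst k).
Proof.
split=> // x y; apply: powser_ext => -[|n]; first by rewrite pcoef0_mul.
by rewrite /= big1 // => -[[|j] lt_j] _ /=; rewrite ?mulr0 // mul0r.
Qed.
HB.instance Definition _ :=
  GRing.isZmodMorphism.Build k (powser k) (@powser_cst k) powser_cst_zmod.
HB.instance Definition _ :=
  GRing.isMonoidMorphism.Build k (powser k) (@powser_cst k) powser_cst_monoid.
End PowserTheory.

Lemma frac_div (R : idomainType) (x : {fraction R}) :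
  exists n m : R, m != 0 /\ x = tofrac n / tofrac m.
Proof.
elim/quotW: x => x; exists (frac x).1, (frac x).2; split; first exact: denom_ratioP.
have m0 := denom_ratioP x.
rewrite -{1}(FracField.Ratio_numden x).
set n := (frac x).1; set m := (frac x).2 in m0 *.
apply: (canRL (mulfK _)); first by rewrite tofrac_eq0.
rewrite !piE; apply/eqmodP => /=.
by rewrite /= FracField.equivfE /FracField.mulf !numden_Ratio ?mulr1 ?oner_eq0 //= mulrC.
Qed.

Section LaurentBasics.
Variable k : fieldType.
Local Notation L := (laurent k).

Lemma lseries_zmod : zmod_morphism (@lseries k).
Proof. exact: tofracB. Qed.
Lemma lseries_monoid : monoid_morphism (@lseries k).
Proof. by split; [exact: tofrac1 | exact: tofracM]. Qed.
HB.instance Definition _ :=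
  GRing.isZmodMorphism.Build (powser k) L (@lseries k) lseries_zmod.
HB.instance Definition _ :=
  GRing.isMonoidMorphism.Build (powser k) L (@lseries k) lseries_monoid.

Lemma lcst_zmod : zmod_morphism (@lcst k).
Proof. by move=> x y; rewrite /lcst raddfB raddfB. Qed.
Lemma lcst_monoid : monoid_morphism (@lcst k).
Proof. by split=> [|x y]; rewrite /lcst ?rmorph1 ?rmorph1 // rmorphM rmorphM. Qed.
HB.instance Definition _ := GRing.isZmodMorphism.Build k L (@lcst k) lcst_zmod.
HB.instance Definition _ := GRing.isMonoidMorphism.Build k L (@lcst k) lcst_monoid.

Lemma lseries_inj : injective (@lseries k).
Proof. by move=> x y /eqP; rewrite tofrac_eq => /eqP. Qed.

Lemma laurent_div (f : L) : exists g h, h != 0 /\ f = lseries g / lseries h.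
Proof. exact: frac_div. Qed.
End LaurentBasics.

#[local] Opaque laurent lseries.

Lemma powers_div (F : fieldType) (t a b v : F) n m : t != 0 -> v = b^-1 ->
  t^-1 ^+ n * a / (t^-1 ^+ m * b) = t ^ (m%:Z - n%:Z) * (a * v).
Proof.
move=> t0 ->; rewrite invfM -exprVn invrK mulrACA expfzDr // -exprnN exprVn.
by rewrite [X in X * _ = _]mulrC.
Qed.

Section LaurentOrder.
Variable k : fieldType.
Local Notation L := (laurent k).
Local Notation T := (lT k).
Implicit Types f g : L.

Lemma lseries_X_neq0 : lseries (powserX k) != 0.
Proof.
rewrite -(rmorph0 (@lseries k)) (inj_eq (@lseries_inj k)); apply/eqP.
by move/(congr1 (fun h => pcoef h 1)) => /= /eqP; rewrite oner_eq0.
Qed.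

Lemma lT_neq0 : T != 0.
Proof. by rewrite /lT invr_eq0 lseries_X_neq0. Qed.

Lemma lTV : T^-1 = lseries (powserX k).
Proof. by rewrite /lT invrK. Qed.

#[local] Opaque lT.

(* A negative n means that f has a zero of order -n at infinity. *)
Definition pole_order f (n : int) :=
  exists2 w : powser k, pcoef w 0 != 0 & f = T ^ n * lseries w.

Lemma pole_order_ex f : f != 0 -> exists n, pole_order f n.
Proof.
move=> f0; have [g [h [h0 fE]]] := laurent_div f.
have g0 : g != 0 by apply: contra_neq f0 => g0; rewrite fE g0 rmorph0 mul0r.
have [n [g' [g'0 gE]]] := powser_order g0; have [m [h' [h'0 hE]]] := powser_order h0.
have [v hv] := powser_inv h'0.
have v0 : pcoef v 0 != 0.
  have /(congr1 (fun h => pcoef h 0)) := hv; rewrite pcoef0_mul => hv0.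
  by apply: contra_eq_neq hv0 => ->; rewrite mulr0 eq_sym oner_neq0.
exists (m%:Z - n%:Z), (g' * v); first by rewrite pcoef0_mul mulf_neq0.
have hvL : lseries h' * lseries v = 1 by rewrite -rmorphM hv rmorph1.
have h'n0 : lseries h' != 0.
  by apply: contra_eq_neq hvL => ->; rewrite mul0r eq_sym oner_neq0.
rewrite fE gE hE rmorphM [lseries (_ ^+ m * _)]rmorphM !rmorphXn /= -lTV.
have vE : lseries v = (lseries h')^-1 by apply: (mulfI h'n0); rewrite mulfV.
by rewrite rmorphM (powers_div _ _ _ lT_neq0 vE).
Qed.

Lemma pole_order_neq0 f n : pole_order f n -> f != 0.
Proof.
case=> w w0 ->; rewrite mulf_neq0 ?expfz_neq0 ?lT_neq0 //.
rewrite -(rmorph0 (@lseries k)) (inj_eq (@lseries_inj k)).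
by apply: contra_neq w0 => ->.
Qed.

Lemma pole_orderM f g n m :
  pole_order f n -> pole_order g m -> pole_order (f * g) (n + m).
Proof.
case=> w w0 -> [v v0 ->]; exists (w * v); first by rewrite pcoef0_mul mulf_neq0.
by rewrite rmorphM expfzDr ?lT_neq0 // mulrACA.
Qed.

Lemma pole_orderV f n : pole_order f n -> pole_order f^-1 (- n).
Proof.
case=> w w0 ->; have [v wv] := powser_inv w0; exists v.
  have /(congr1 (fun h => pcoef h 0)) := wv; rewrite pcoef0_mul => wv0.
  by apply: contra_eq_neq wv0 => ->; rewrite mulr0 eq_sym oner_neq0.
have wvL : lseries w * lseries v = 1 by rewrite -rmorphM wv rmorph1.
have wn0 : lseries w != 0.
  by apply: contra_eq_neq wvL => ->; rewrite mul0r eq_sym oner_neq0.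
by rewrite invfM -invr_expz; congr (_ * _); apply: (mulfI wn0); rewrite mulfV.
Qed.

Lemma pole_order_cst c : c != 0 -> pole_order (lcst c) 0.
Proof. by move=> c0; exists (powser_cst c); rewrite // expr0z mul1r. Qed.

Lemma pole_orderX f n m : pole_order f n -> pole_order (f ^+ m) (n * m%:Z).
Proof.
move=> fn; elim: m => [|m IHm].
  by rewrite mulr0 expr0 -(rmorph1 (@lcst k)); apply/pole_order_cst/oner_neq0.
by rewrite exprS intS mulrDr mulr1; apply: pole_orderM.
Qed.

Lemma pole_order_T : pole_order T 1.
Proof. by exists 1; rewrite ?oner_neq0 // rmorph1 mulr1 expr1z. Qed.

Lemma lregularP f : reflect (exists s, f = lseries s) (f \in @lregular k).
Proof. exact: asboolP. Qed.

Lemma lregular_subring : subring_closed (@lregular k).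
Proof.
split; first by apply/lregularP; exists 1; rewrite rmorph1.
  move=> _ _ /lregularP[f ->] /lregularP[g ->]; apply/lregularP.
  by exists (f - g); rewrite rmorphB.
move=> _ _ /lregularP[f ->] /lregularP[g ->]; apply/lregularP.
by exists (f * g); rewrite rmorphM.
Qed.

Lemma lregular_cst c : lcst c \in @lregular k.
Proof. by apply/lregularP; exists (powser_cst c). Qed.

Lemma lTV_regular : T^-1 \in @lregular k.
Proof. by apply/lregularP; exists (powserX k); rewrite lTV. Qed.

Lemma pole_order_regular f n : pole_order f n -> (f \in @lregular k) = (n <= 0).
Proof.
case=> w w0 ->; case: (lerP n 0) => n0.
  have [m mE] : exists m : nat, n = - m%:Z by exists `|n|%N; lia.
  apply/lregularP; exists (powserX k ^+ m * w).
  by rewrite rmorphM rmorphXn /= -lTV exprVn mE -exprnN.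
apply/negP => /lregularP[g]; have [m mE] : exists m : nat, n = m.+1%:Z.
  by exists `|n|.-1%N; lia.
rewrite mE -exprnP => gE; have : w = powserX k * (powserX k ^+ m * g).
  apply: lseries_inj; rewrite mulrA -exprS rmorphM /= -gE rmorphXn /= -lTV exprVn.
  by rewrite mulrA mulVf ?mul1r // expf_neq0 ?lT_neq0.
by move/(congr1 (fun h => pcoef h 0)); rewrite pcoefX_mul0 => w0'; rewrite w0' eqxx in w0.
Qed.

Lemma pole_order_inj f n m : pole_order f n -> pole_order f m -> n = m.
Proof.
move=> fn fm; have f0 := pole_order_neq0 fn.
have := pole_orderM fn (pole_orderV fm); rewrite mulfV // => h1.
have := pole_orderM fm (pole_orderV fn); rewrite mulfV // => h2.
have r1 : 1 \in @lregular k by case: lregular_subring.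
have := pole_order_regular h1; have := pole_order_regular h2.
by rewrite !r1; lia.
Qed.

Lemma lT_regularN : T \notin @lregular k.
Proof. by rewrite (pole_order_regular pole_order_T). Qed.

Lemma lregular_val f : f \in @lregular k \/ f^-1 \in @lregular k.
Proof.
have [->|f0] := eqVneq f 0.
  by left; apply/lregularP; exists 0; rewrite rmorph0.
have [n fn] := pole_order_ex f0.
rewrite (pole_order_regular fn) (pole_order_regular (pole_orderV fn)).
by apply/orP; lia.
Qed.

Lemma pole_orderD_cst f n c : pole_order f n -> 0 < n -> pole_order (f + lcst c) n.
Proof.
case=> w w0 -> n0; have [m mE] : exists m : nat, n = m.+1%:Z.
  by exists `|n|.-1%N; lia.
exists (w + powserX k * (powserX k ^+ m * powser_cst c)).
  have -> : pcoef (w + powserX k * (powserX k ^+ m * powser_cst c)) 0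
    = pcoef w 0 + pcoef (powserX k * (powserX k ^+ m * powser_cst c)) 0 by [].
  by rewrite pcoefX_mul0 addr0.
rewrite [powserX k * _]mulrA -exprS raddfD /= rmorphM /= mulrDr rmorphXn /=.
rewrite -lTV exprVn mE -exprnP mulrA.
by rewrite mulfV ?mul1r // expf_neq0 ?lT_neq0.
Qed.

Lemma pole_order_sub f g n : pole_order f n -> pole_order g n ->
  exists2 c, c != 0 & f - lcst c * g = 0 \/
    exists2 m, m < n & pole_order (f - lcst c * g) m.
Proof.
case=> w w0 fE [v v0 gE]; set c := pcoef w 0 / pcoef v 0.
exists c; first by rewrite mulf_neq0 ?invr_eq0.
have [h hE] : exists h, w - powser_cst c * v = powserX k * h.
  apply: powser_mulX.
  have -> : pcoef (w - powser_cst c * v) 0 = pcoef w 0 - pcoef (powser_cst c * v) 0 by [].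
  by rewrite pcoef0_mul /= divfK ?subrr.
have dE : f - lcst c * g = T ^ (n - 1) * lseries h.
  have -> : lcst c * g = T ^ n * lseries (powser_cst c * v).
    by rewrite gE [lseries (_ * v)]rmorphM /= mulrCA.
  rewrite fE -mulrBr -rmorphB hE rmorphM /= mulrA -lTV.
  by rewrite expfzDr ?lT_neq0 // exprN1.
have [->|h0] := eqVneq (f - lcst c * g) 0; [by left | right].
have hn0 : lseries h != 0 by apply: contra_neq h0 => h0; rewrite dE h0 mulr0.
have [r hr] := pole_order_ex hn0.
have r0 : r <= 0 by rewrite -(pole_order_regular hr); apply/lregularP; exists h.
exists (n - 1 + r); first by lia.
rewrite dE; apply: pole_orderM hr; exists 1; rewrite ?oner_neq0 //.
by rewrite rmorph1 mulr1.
Qed.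

(** In each Horner step the pole of q(f) f absorbs the added constant, so nothing cancels. In
    particular f is transcendental over k. *)
Lemma horner_pole_order f n (q : {poly k}) : pole_order f n -> 0 < n -> q != 0 ->
  pole_order (map_poly (@lcst k) q).[f] (n * (size q).-1%:Z).
Proof.
move=> fn n0; elim/poly_ind: q => [|q c IHq]; first by rewrite eqxx.
move=> qc0; rewrite rmorphD rmorphM /= map_polyX map_polyC /= hornerMXaddC.
have [q0|q0] := eqVneq q 0.
  rewrite q0 mul0r add0r in qc0 *; rewrite polyC_eq0 in qc0.
  rewrite size_polyC qc0 mulr0 rmorph0 horner0 mul0r add0r.
  exact: pole_order_cst.
have qf := pole_orderM (IHq q0) fn; rewrite size_MXaddC (negPf q0) /=.
have -> : n * (size q)%:Z = n * (size q).-1%:Z + n.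
  have sq : (0 < size q)%N by rewrite size_poly_gt0.
  by rewrite -{3}[n]mulr1 -mulrDr; congr (_ * _); lia.
by apply: pole_orderD_cst qf _; rewrite ltr_wpDl // mulr_ge0 // ltW.
Qed.
End LaurentOrder.

(** * Extension of valuations *)

Lemma exprV_mul (F : fieldType) (v : F) i n : v != 0 -> (i <= n)%N ->
  v^-1 ^+ i * v ^+ n = v ^+ (n - i).
Proof.
move=> v0 /subnK; move: (n - i)%N => e <-.
by rewrite exprD mulrCA -exprMn mulVf // expr1n mulr1.
Qed.

Section ValuationExtension.
Variables (L : fieldType) (E B0 : {pred L}) (f : L).
Hypotheses (E_div : divring_closed E) (B0_ring : subring_closed B0).
Hypotheses (B0E : {subset B0 <= E}) (fNB0 : f \notin B0) (fVB0 : f^-1 \in B0).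

Lemma subring_closed0 (A : {pred L}) : subring_closed A -> 0 \in A.
Proof. by case=> A1 AB _; rewrite -(subrr 1) AB. Qed.

Lemma subring_closedN (A : {pred L}) : subring_closed A -> {in A, forall x, - x \in A}.
Proof. by move=> Ar x Ax; rewrite -sub0r; have [_ AB _] := Ar; rewrite AB ?subring_closed0. Qed.

Lemma subring_closedD (A : {pred L}) :
  subring_closed A -> {in A &, forall x y, x + y \in A}.
Proof.
move=> Ar x y Ax Ay; rewrite -[y]opprK; have [_ AB _] := Ar.
by rewrite AB // subring_closedN.
Qed.

Lemma subring_closed_sum (A : {pred L}) (I : Type) (r : seq I) (P : pred I) (F : I -> L) :
  subring_closed A -> (forall i, P i -> F i \in A) -> \sum_(i <- r | P i) F i \in A.
Proof.
move=> Ar AF; apply: (big_ind (fun x => x \in A)) => //.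
  exact: subring_closed0.
by move=> x y; apply: subring_closedD.
Qed.

Lemma subring_closedX (A : {pred L}) n : subring_closed A -> {in A, forall x, x ^+ n \in A}.
Proof.
case=> A1 _ AM x Ax; elim: n => [|n IHn] //; rewrite exprS; exact: AM.
Qed.

Definition adjoin (A : {pred L}) (g : L) : {pred L} := fun x =>
  `[< exists2 q : {poly L}, (forall i, q`_i \in A) & x = q.[g] >].

Lemma adjoin_subring A g : subring_closed A -> subring_closed (adjoin A g).
Proof.
move=> Ar; have [A1 AB AM] := Ar; have A0 := subring_closed0 Ar.
split=> [|_ _ /asboolP[q qA ->] /asboolP[r rA ->]|_ _ /asboolP[q qA ->] /asboolP[r rA ->]].
- apply/asboolP; exists 1; last by rewrite hornerE.
  by move=> i; rewrite coef1; case: (i == _).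
- by apply/asboolP; exists (q - r) => [i|]; rewrite ?hornerE // coefB AB.
apply/asboolP; exists (q * r) => [i|]; rewrite ?hornerM // coefM.
by apply: subring_closed_sum => // j _; apply: AM.
Qed.

Lemma adjoin_sub A g : subring_closed A -> {subset A <= adjoin A g}.
Proof.
move=> Ar x Ax; apply/asboolP; exists x%:P; last by rewrite hornerC.
by move=> i; rewrite coefC; case: ifP => // _; apply: subring_closed0.
Qed.

Lemma adjoin_gen A g : subring_closed A -> g \in adjoin A g.
Proof.
move=> Ar; apply/asboolP; exists 'X; last by rewrite hornerX.
move=> i; rewrite coefX; case: (i == _); [by case: Ar | exact: subring_closed0].
Qed.

Lemma divringV x : x \in E -> x^-1 \in E.
Proof. by case: E_div => E1 _ EV Ex; rewrite -[x^-1]mul1r EV. Qed.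

Lemma divring_subring : subring_closed E.
Proof.
have [E1 EB EV] := E_div; split=> // x y xE yE.
by rewrite -[y]invrK EV ?divringV.
Qed.

Lemma adjoin_subE A g : {subset A <= E} -> g \in E -> {subset adjoin A g <= E}.
Proof.
move=> AE gE _ /asboolP[q qA ->]; rewrite horner_coef; have Er := divring_subring.
apply: subring_closed_sum => // i _; have [_ _ EM] := Er.
by apply: EM; [apply: AE | apply: subring_closedX].
Qed.

Section Maximal.
Variable A : {pred L}.
Hypotheses (Ar : subring_closed A) (AE : {subset A <= E}) (B0A : {subset B0 <= A}).
Hypothesis fNA : f \notin A.
Hypothesis A_max : forall g, g \in E -> g \notin A -> f \in adjoin A g.

Let t := f^-1.
Let tA : t \in A. Proof. exact: B0A. Qed.
Let f0 : f != 0. Proof. by apply: contra fNA => /eqP->; apply: subring_closed0. Qed.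
Let ft : t * f = 1. Proof. exact: mulVf. Qed.

(** If v = 1 - t c were not a unit, maximality would make f a polynomial in 1/v, so f v^N would lie
    in A for some N. But v^N = 1 - t c' with c' in A, so f v^N = f - c' and f would lie in A. *)
Let unit_near1 c : c \in A -> (1 - t * c)^-1 \in A.
Proof.
move=> cA; have [A1 AB AM] := Ar; set v := 1 - t * c.
have vA : v \in A by rewrite AB ?AM.
have v0 : v != 0.
  apply: contra fNA; rewrite subr_eq0 => /eqP tc.
  by rewrite -[f]mulr1 tc mulrA [f * t]mulrC ft mul1r.
have [//|vV] := boolP (v^-1 \in A).
have /asboolP[q qA fq] := A_max (divringV (AE vA)) vV.
have [c' c'A vc'] : exists2 c', c' \in A & v ^+ size q = 1 - t * c'.
  elim: (size q) => [|n [c' c'A IHn]].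
    by exists 0; rewrite ?expr0 ?mulr0 ?subr0 // subring_closed0.
  exists (c' + c - t * c * c'); last by rewrite exprSr IHn /v; ring.
  by apply: AB; [apply: subring_closedD | apply: (AM) => //; apply: (AM)].
case/negP: fNA; have -> : f = f * v ^+ size q + c'.
  by rewrite vc' mulrBr mulr1 mulrA [f * t]mulrC ft mul1r subrK.
apply: subring_closedD => //; rewrite {1}fq horner_coef mulr_suml.
apply: subring_closed_sum => // i _; rewrite -mulrA; apply: AM => //.
rewrite exprV_mul // ?(ltnW (ltn_ord i)) //.
exact: subring_closedX.
Qed.

(** The membership of f in A[g], multiplied by t = 1/f, with a bound n on the degree. *)
Let rel g n := exists q : {poly L},
  [/\ forall i, q`_i \in A, (size q <= n.+1)%N & 1 = t * q.[g]].

(** The relation for 1/g, multiplied by g^(n+1) and divided by the unit 1 - t r_0, expresses g^(n+1)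
    through lower powers of g. This removes the top term of the relation for g. *)
Let rel_step g n m : g != 0 -> (m <= n.+1)%N -> rel g n.+1 -> rel g^-1 m -> rel g n.
Proof.
move=> g0 le_mn [q [qA qs q1]] [r [rA rs r1]]; have [A1 AB AM] := Ar.
set v := 1 - t * r`_0; have vV : v^-1 \in A by apply: unit_near1.
have v0 : v != 0.
  apply: contra fNA; rewrite subr_eq0 => /eqP tc.
  by rewrite -[f]mulr1 tc mulrA [f * t]mulrC ft mul1r.
have gn : g ^+ n.+1 = v^-1 * (t * \sum_(i < n.+1) r`_(n.+1 - i) * g ^+ i).
  apply: (mulfI v0); rewrite [RHS]mulrA mulfV // mul1r.
  have -> : v = t * \sum_(j < n.+1) r`_j.+1 * g^-1 ^+ j.+1.
    rewrite /v {1}r1 (@horner_coef_wide _ n.+2); last by apply: leq_trans rs _.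
    by rewrite big_ord_recl /= expr0 mulr1 mulrDr addrC addKr.
  rewrite -mulrA; congr (_ * _); rewrite mulr_suml (reindex_inj rev_ord_inj) /=.
  apply: eq_bigr => i _; rewrite subSS; have lt_i := ltn_ord i.
  rewrite -subSn // -mulrA exprV_mul ?leq_subr // subKn //.
  exact: ltnW.
exists (\poly_(i < n.+1) (q`_i + q`_n.+1 * (v^-1 * (t * r`_(n.+1 - i))))).
split; last 1 first.
- rewrite horner_poly {1}q1 (@horner_coef_wide _ n.+2) // big_ord_recr /= gn.
  congr (_ * _).
  have -> : q`_n.+1 * (v^-1 * (t * \sum_(i < n.+1) r`_(n.+1 - i) * g ^+ i))
      = \sum_(i < n.+1) q`_n.+1 * (v^-1 * (t * r`_(n.+1 - i))) * g ^+ i.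
    rewrite !mulr_sumr; apply: eq_bigr => i _; rewrite -!mulrA //.
  by rewrite -big_split /=; apply: eq_bigr => i _; rewrite mulrDl.
- move=> i; rewrite coef_poly; case: ifP => _; last exact: subring_closed0.
  by apply: subring_closedD => //; do 3 (apply: (AM) => //).
exact: size_poly.
Qed.

(** Descent on n + m: the relation of larger degree is shortened by the other one. In degree 0 it
    would say that f is in A. *)
Let rel_false N g n m : (n + m <= N)%N -> g != 0 -> rel g n -> rel g^-1 m -> False.
Proof.
have rel0 h : rel h 0 -> False.
  move=> [q [qA qs q1]]; case/negP: fNA.
  rewrite (size1_polyC qs) hornerC in q1.
  by rewrite -[f]mulr1 q1 mulrA [f * t]mulrC ft mul1r.
elim: N g n m => [|N IHN] g n m le_N g0 gn gm.
  by move: le_N gn; rewrite leqn0 addn_eq0 => /andP[/eqP-> _]; apply: rel0.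
case: n le_N gn => [_ /rel0 //|n le_N gn].
case: m le_N gm => [_ /rel0 //|m le_N gm].
have [le_mn|lt_nm] := leqP m.+1 n.+1.
  by apply: (IHN g n m.+1 _ g0 (rel_step g0 le_mn gn gm) gm); lia.
have gV0 : g^-1 != 0 by rewrite invr_eq0.
have gn' : rel g^-1^-1 n.+1 by rewrite invrK.
by apply: (IHN g n.+1 m _ g0 gn (rel_step gV0 (ltnW lt_nm) gm gn')); lia.
Qed.

Lemma maximal_valuation : {in E, forall g, g \in A \/ g^-1 \in A}.
Proof.
move=> g gE; have [gA|gA] := boolP (g \in A); first by left.
right; apply/negPn/negP => gV.
have g0 : g != 0 by apply: contra gA => /eqP->; apply: subring_closed0.
have relP h : f \in adjoin A h -> exists n, rel h n.
  move=> /asboolP[q qA fq]; exists (size q), q; split=> //.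
  by rewrite -fq ft.
have [n gn] := relP _ (A_max gE gA); have [m gm] := relP _ (A_max (divringV gE) gV).
exact: rel_false (leqnn _) g0 gn gm.
Qed.
End Maximal.

(** Chevalley's theorem inside E: a subring maximal among those that contain B0 and avoid f is a
    valuation ring. *)
Lemma valuation_extension : exists O : {pred L},
  [/\ {subset B0 <= O}, {subset O <= E}, subring_closed O, f \notin O &
      {in E, forall g, g \in O \/ g^-1 \in O}].
Proof.
pose pr (A : L -> Prop) : {pred L} := fun x => `[< A x >].
pose good (A : L -> Prop) := [/\ {subset B0 <= pr A}, {subset pr A <= E},
  subring_closed (pr A) & f \notin pr A].
have prE (A : L -> Prop) x : x \in pr A <-> A x by split=> /asboolP.
have [F FP F_tot|A [Agood A_max]] := @classical_sets.Zorn_bigcup L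
    (fun A => good A \/ forall x, ~ A x).
  have [[A0 [FA0 A0good]]|noA] := pselect (exists A, F A /\ good A); last first.
    right=> x [A FA Ax]; have [Agood|/(_ x)//] := FP A FA.
    by apply: noA; exists A.
  have goodF A x : F A -> A x -> good A.
    by move=> FA Ax; have [//|/(_ x)] := FP A FA.
  have [A0sub _ [A01 _ _] _] := A0good.
  have both x y : x \in pr (classical_sets.bigcup F (fun X => X)) ->
      y \in pr (classical_sets.bigcup F (fun X => X)) ->
      exists A, [/\ F A, good A, x \in pr A & y \in pr A].
    move=> /prE[A FA Ax] /prE[B FB By].
    have [AB|BA] := F_tot A B FA FB.
      by exists B; split=> //; [apply: goodF By | apply/prE/AB | apply/prE].
    by exists A; split=> //; [apply: goodF Ax | apply/prE | apply/prE/BA].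
  left; split.
  - by move=> x /A0sub/prE A0x; apply/prE; exists A0.
  - by move=> x xF; have [A [_ [_ AE _ _] xA _]] := both x x xF xF; apply: AE.
  - split; first by apply/prE; exists A0 => //; apply/prE.
      move=> x y xF yF; have [A [FA [_ _ [_ AB _] _] xA yA]] := both x y xF yF.
      by apply/prE; exists A => //; apply/prE; apply: AB.
    move=> x y xF yF; have [A [FA [_ _ [_ _ AM] _] xA yA]] := both x y xF yF.
    by apply/prE; exists A => //; apply/prE; apply: AM.
  by apply/negP => fF; have [A [_ [_ _ _ /negP fN] fA _]] := both f f fF fF.
have B0good : good (fun x => x \in B0).
  have B0pr : pr (fun x => x \in B0) =i B0 by move=> x; apply/asboolP/idP.
  have [B1 BB BM] := B0_ring; split.
  - by move=> x; rewrite B0pr.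
  - by move=> x; rewrite B0pr; apply: B0E.
  - by split=> [|x y|x y]; rewrite !B0pr; [|apply: BB | apply: BM].
  by rewrite B0pr.
have {}Agood : good A.
  case: Agood => // A0; case: (A_max (fun x => x \in B0)); last by left.
  split=> [x /A0 //|/(_ 1)]; have [B1 _ _] := B0_ring.
  by move=> /(_ B1)/A0.
have [B0A AE Ar fNA] := Agood; exists (pr A); split=> //.
apply: maximal_valuation => // g gE gA; apply/negPn/negP => fN.
(* If f were not in A[g], this ring would be a strictly larger candidate than A. *)
case: (A_max (fun x => x \in adjoin (pr A) g)).
  split=> [x Ax|/(_ g)]; first by apply: adjoin_sub => //; apply/prE.
  by move=> /(_ (adjoin_gen g Ar))/prE gA'; rewrite gA' in gA.
left; have adpr : pr (fun x => x \in adjoin (pr A) g) =i adjoin (pr A) g.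
  by move=> x; apply/asboolP/idP.
have [D1 DB DM] := adjoin_subring g Ar; split.
- by move=> x /B0A xA; rewrite adpr; apply: adjoin_sub.
- by move=> x; rewrite adpr; apply: adjoin_subE.
- by split=> [|x y|x y]; rewrite !adpr; [|apply: DB | apply: DM].
by rewrite adpr.
Qed.
End ValuationExtension.

(** * Polynomial parametrizations *)

Lemma coprimep_affine (k : fieldType) (P : {poly k}) (c e : k) : e != 0 ->
  coprimep P (c%:P * P + e%:P).
Proof.
move=> e0; apply/Bezout_coprimepP; exists (- c%:P, 1) => /=.
by rewrite mul1r addrA mulNr addNr add0r polyC_eqp1.
Qed.

Lemma log_deriv_identity (S : comNzRingType) (p z q D x y a b : S) :
  q * (p * z) * (D * x * a * (z * y) + p * x * (D * y * b))
    = p * x * (z * y) * (q * D * (a * z + b * p)).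
Proof. by ring. Qed.

Section NoParametrization.
Variables (k : fieldType) (d a b : nat) (P Q : {poly k}).
Hypothesis k_char0 : forall n, (0 < n)%N -> n%:R != 0 :> k.
Hypotheses (a_bounds : (1 < a < d)%N) (bE : b = (d + 1 - a)%N).
Hypotheses (sP : size P = d.+1) (PQ : Q ^+ d = P ^+ a * (P - 1) ^+ b).

Let P0 : P != 0. Proof. by rewrite -size_poly_eq0 sP. Qed.
Let sP1 : size (P - 1) = d.+1.
Proof. by rewrite size_polyDl ?sP // size_polyN size_poly1 ltnS; lia. Qed.
Let P10 : P - 1 != 0. Proof. by rewrite -size_poly_eq0 sP1. Qed.
Let H := P * (P - 1).
Let H0 : H != 0. Proof. by rewrite mulf_neq0. Qed.
Let sH : size H = (2 * d).+1.
Proof. by rewrite size_mul // sP sP1; lia. Qed.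

Let sQ : size Q = d.+2.
Proof.
have := size_exp Q d; rewrite PQ size_mul ?expf_neq0 //.
have := size_exp P a; have := size_exp (P - 1) b; rewrite sP sP1 /=.
have : (0 < size (P ^+ a))%N by rewrite size_poly_gt0 expf_neq0.
have : (0 < size ((P - 1) ^+ b))%N by rewrite size_poly_gt0 expf_neq0.
move=> s1 s2 e1 e2 e3; have : ((size Q).-1 * d = (d + 1) * d)%N.
  have ab : (a + b = d + 1)%N by lia.
  rewrite -e3 -ab mulnDl [(a * d)%N]mulnC [(b * d)%N]mulnC -e1 -e2.
  by case: (size (P ^+ a)) (size ((P - 1) ^+ b)) s1 s2 => [|n1] [|n2] // _ _; rewrite addSn addnS.
have d0 : (0 < d)%N by lia.
by move/eqP; rewrite eqn_pmul2r // => /eqP; move: (size Q) => [|n] /=; lia.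
Qed.

Let D := P^`().
Let sD : (size D <= d)%N.
Proof. by have := lt_size_deriv P0; rewrite sP ltnS. Qed.
Let D0 : D != 0.
Proof.
apply/eqP => /(congr1 (fun q : {poly k} => q`_d.-1)); rewrite coef0 coef_deriv.
have d0 : (0 < d)%N by lia.
rewrite prednK // => /eqP; rewrite -mulr_natr mulf_eq0 (negPf (k_char0 d0)) orbF.
have -> : P`_d = lead_coef P by rewrite lead_coefE sP.
by rewrite lead_coef_eq0 (negPf P0).
Qed.

Let U := a%:R * (P - 1) + b%:R * P.

(** The logarithmic derivative d Q'/Q = a P'/P + b P'/(P - 1), cleared of denominators. *)
Let derivPQ : d%:R * Q^`() * H = Q * D * U.
Proof.
have d0 : (0 < d)%N by lia.
have [a' aE] : exists a', a = a'.+1 by exists a.-1; lia.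
have [b' bE'] : exists b', b = b'.+1 by exists b.-1; lia.
have [d' dE] : exists d', d = d'.+1 by exists d.-1; lia.
have Qd0 : Q ^+ d != 0 by rewrite PQ mulf_neq0 ?expf_neq0.
have : Q * H * (Q ^+ d)^`() = Q * H * (P ^+ a * (P - 1) ^+ b)^`() by rewrite PQ.
rewrite derivM !deriv_exp derivB -[1]/(1%:P) derivC subr0 -/D => E.
apply: (mulfI Qd0); transitivity (Q * H * (Q^`() * Q ^+ d.-1 *+ d)).
  by rewrite -mulr_natr dE /= exprS; ring.
rewrite E PQ -[D * _ *+ a]mulr_natr -[D * _ *+ b]mulr_natr /H /U aE bE' /= !exprS.
exact: log_deriv_identity.
Qed.

Let coHU : coprimep H U.
Proof.
rewrite coprimepMl; apply/andP; split.
  have -> : U = (a%:R + b%:R)%:P * P + (- a%:R)%:P.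
    by rewrite /U polyCN polyCD -!polyC_natr; ring.
  by apply: coprimep_affine; rewrite oppr_eq0 k_char0 //; lia.
have -> : U = (a%:R + b%:R)%:P * (P - 1) + (b%:R)%:P.
  by rewrite /U polyCD -!polyC_natr; ring.
by apply: coprimep_affine; rewrite k_char0 //; lia.
Qed.

(** By [derivPQ], H divides Q P'; as H has degree 2d and Q P' at most 2d, Q P' = K H with K
    constant. Differentiating again gives d P'' H = P'^2 V, where V is a - d modulo P and a - 1
    modulo P - 1. Both are nonzero for 1 < a < d, so H divides P'^2, whose degree is at most 2d -
    2. *)
Lemma no_parametrization : False.
Proof.
have Q0 : Q != 0 by rewrite -size_poly_eq0 sQ.
have U0 : U != 0.
  apply: contraTneq coHU => ->; rewrite coprimep0 -size_poly_eq1 sH.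
  by rewrite eqSS muln_eq0; lia.
have dk0 : (d%:R : {poly k}) != 0.
  by rewrite -polyC_natr polyC_eq0 k_char0 //; lia.
have [K KE] : exists K, Q * D = K * H.
  apply/dvdpP; rewrite -(Gauss_dvdpl _ coHU) -derivPQ.
  exact: dvdp_mull.
have K0 : K != 0.
  by apply: contraTneq (mulf_neq0 Q0 D0) => K0; rewrite KE K0 mul0r eqxx.
have sK : (size K <= 1)%N.
  have := congr1 (fun q : {poly k} => size q) KE; rewrite (size_mul Q0 D0) (size_mul K0 H0) sQ sH.
  by move: sD; move: (size D) (size K) => x y; lia.
have dQ : d%:R * Q^`() = K * U.
  by apply: (mulIf H0); rewrite derivPQ KE; ring.
have K' : K^`() = 0 by rewrite (size1_polyC sK) derivC.
(* What remains of the derivative of Q D = K H once Q' is eliminated by [dQ]. *)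
pose V := d%:R * (2%:R * P - 1) - U.
have D2V : d%:R * D^`() * H = D ^+ 2 * V.
  have := congr1 (fun q : {poly k} => d%:R * D * q^`()) KE.
  rewrite !derivM K' mul0r add0r derivB -[1]/(1%:P) derivC subr0 -/D => E.
  apply: (mulfI K0).
  transitivity (d%:R * D^`() * (Q * D)); first by rewrite KE; ring.
  transitivity (d%:R * D * (Q^`() * D + Q * D^`()) - (d%:R * Q^`()) * D ^+ 2).
    by ring.
  by rewrite E dQ /V; ring.
have coHV : coprimep H V.
  have abE : (a%:R + b%:R = d%:R + 1 :> {poly k}).
    by rewrite -natrD -[1]/(1%:R) -natrD; congr (_%:R); lia.
  rewrite coprimepMl; apply/andP; split.
    have -> : V = (2%:R * d%:R - (d%:R + 1))%:P * P + (- (d - a)%:R)%:P.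
      rewrite /V /U polyCN !polyCB polyCD polyCM natrB; last by lia.
      rewrite polyCB -!polyC_natr polyC1.
      transitivity (d%:R * (2%:R * P - 1) - ((a%:R + b%:R) * P - a%:R)); first by ring.
      by rewrite abE; ring.
    by apply: coprimep_affine; rewrite oppr_eq0 k_char0 //; lia.
  have -> : V = (2%:R * d%:R - (d%:R + 1))%:P * (P - 1) + ((a - 1)%:R)%:P.
    rewrite /V /U !polyCB polyCD polyCM natrB; last by lia.
    rewrite polyCB -!polyC_natr polyC1.
    transitivity (d%:R * (2%:R * P - 1) - ((a%:R + b%:R) * P - a%:R)); first by ring.
    by rewrite abE; ring.
  by apply: coprimep_affine; rewrite k_char0 //; lia.
have : H %| D ^+ 2.
  by rewrite -(Gauss_dvdpl _ coHV) -D2V; apply: dvdp_mull.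
move/dvdp_leq; rewrite expf_neq0 // => /(_ isT).
rewrite sH expr2 (size_mul D0 D0) leqNgt; case/negP.
by move: sD; move: (size D) => x; lia.
Qed.
End NoParametrization.

(** * Functions on the curve *)

#[local] Opaque laurent lseries lT lcst.

Lemma opp_absz_nonpos (n : int) : n <= 0 -> - `|n|%N%:Z = n.
Proof. by lia. Qed.

Lemma residue_mul (R : comNzRingType) (q h r g t : R) :
  (q + t * h) * (r + t * g) = q * r + t * (q * g + h * r + t * (h * g)).
Proof. by ring. Qed.

Lemma residue_eq (R : comNzRingType) (q c h r c' g t e : R) :
  q * t + c + t ^+ 1 * h = r * t + c' + t * e * g ->
  c' - c = t * (q + h - r - e * g).
Proof.
move=> E; have -> : c' = q * t + c + t ^+ 1 * h - r * t - t * e * g.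
  by rewrite E; ring.
by ring.
Qed.

Section Curve.
Variables (k : fieldType) (d a b : nat) (x : laurent k).
Local Notation L := (laurent k).
Local Notation T := (lT k).
Local Notation reg := (@lregular k).
Local Notation K := (function_field x).
Local Notation A := (sections_away_infty x).
Hypotheses (a_bounds : (1 < a < d)%N) (bE : b = (d + 1 - a)%N).
Hypothesis expx : expansion_at_infty d a b x.

Local Notation s := (T^-1).
Local Notation u := (x^-1).

Let T0 : T != 0. Proof. exact: lT_neq0. Qed.
Let reg_ring : subring_closed reg. Proof. exact: lregular_subring. Qed.

Lemma function_field_divring : divring_closed K.
Proof.
split.
- by apply/asboolP => E [].
- move=> f g /asboolP fK /asboolP gK; apply/asboolP => E Ed Ec Ex Ey.
  by have [_ EB _] := Ed; apply: EB; [apply: fK | apply: gK].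
move=> f g /asboolP fK /asboolP gK; apply/asboolP => E Ed Ec Ex Ey.
by have [_ _ EV] := Ed; apply: EV; [apply: fK | apply: gK].
Qed.

Lemma function_field_subring : subring_closed K.
Proof. exact: divring_subring function_field_divring. Qed.

Lemma function_field_cst c : lcst c \in K.
Proof. by apply/asboolP => E _ Ec _ _; apply: Ec. Qed.

Lemma function_field_x : x \in K.
Proof. by apply/asboolP => E _ _ Ex _; apply: Ex. Qed.

Lemma function_field_y : T * x \in K.
Proof. by apply/asboolP => E _ _ _ Ey; apply: Ey. Qed.

Lemma x_neq0 : x != 0.
Proof.
have [_ xN] := expx; apply: contraNneq xN => ->.
exact: subring_closed0.
Qed.

Lemma function_field_T : T \in K.
Proof.
have [_ _ KV] := function_field_divring.
by rewrite -[T](mulfK x_neq0) KV ?function_field_x ?function_field_y.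
Qed.

(** Since a + b = d + 1, exactly one factor x survives the division by x^d. *)
Lemma curve_eq : T ^+ d = x * (1 - u) ^+ b.
Proof.
have [eq_xy _] := expx; apply: (mulIf (expf_neq0 d x_neq0)).
rewrite -exprMn eq_xy.
have -> : x - 1 = x * (1 - u) by rewrite mulrBr mulr1 mulfV ?x_neq0.
rewrite exprMn mulrA -exprD mulrAC -exprS; congr (x ^+ _ * _); lia.
Qed.

Lemma curve_eq_inv : u = s ^+ d * (1 - u) ^+ b.
Proof.
apply: (mulfI (expf_neq0 d T0)).
rewrite [RHS]mulrA -exprMn mulfV // expr1n mul1r curve_eq mulrAC mulfV ?x_neq0 //.
by rewrite mul1r.
Qed.

Lemma pole_order_x : pole_order x d.
Proof.
have [m xm] := pole_order_ex x_neq0; have [_ xN] := expx.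
rewrite (pole_order_regular xm) -ltNge in xN.
have x1m : pole_order (1 - u) 0.
  have -> : 1 - u = (x + lcst (-1)) * u.
    by rewrite mulrDl mulfV ?x_neq0 // rmorphN rmorph1 mulN1r.
  by rewrite -(subrr m); apply: pole_orderM (pole_orderD_cst _ xm xN) (pole_orderV xm).
have := pole_orderM xm (pole_orderX b x1m); rewrite -curve_eq mul0r addr0 => Tm.
have := pole_orderX d (pole_order_T k); rewrite mul1r => Td.
by rewrite (pole_order_inj Td Tm).
Qed.

Lemma pole_order_y : pole_order (T * x) (d.+1)%:Z.
Proof. by rewrite -add1n PoszD; apply: pole_orderM (pole_order_T k) pole_order_x. Qed.

Lemma lT_expN (Z : {pred L}) j : subring_closed Z -> s \in Z -> T \notin Z ->
  T ^+ j.+1 \notin Z.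
Proof.
move=> Zr sZ; apply: contra => TZ; have [_ _ ZM] := Zr.
have -> : T = T ^+ j.+1 * s ^+ j.
  by rewrite exprS -mulrA -exprMn mulfV // expr1n mulr1.
by apply: ZM => //; apply: subring_closedX.
Qed.

(** v T = c T + f is outside Z because T is; hence v^-1 s lies in Z, and v^-1 = c^-1 (1 - f v^-1 s).
    The valuation property is asked of v T alone, because Z is either a point, where it holds only
    for functions on X, or the ring of all regular Laurent series. *)
Lemma unit_near_cst (Z : {pred L}) c f : subring_closed Z ->
    (forall e, lcst e \in Z) -> T \notin Z -> c != 0 -> f \in Z ->
    let v := lcst c + s * f in
    v * T \in Z \/ (v * T)^-1 \in Z -> v^-1 \in Z.
Proof.
move=> Zr Zc TZ c0 fZ v vZ; have [Z1 ZB ZM] := Zr.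
have vT : v * T = lcst c * T + f by rewrite mulrDl mulrAC mulVf // mul1r.
have cV : lcst c^-1 * lcst c = 1 by rewrite -rmorphM mulVf ?rmorph1.
have vTN : v * T \notin Z.
  apply: contra TZ => vTZ; rewrite -[T]mul1r -cV -mulrA; apply: (ZM) => //.
  by rewrite -[_ * T](addrK f) -vT; apply: ZB.
have v0 : v != 0.
  by apply: contraNneq vTN => ->; rewrite mul0r; apply: subring_closed0.
case: vZ => [vTZ|]; first by rewrite vTZ in vTN.
rewrite invfM => eZ.
have -> : v^-1 = lcst c^-1 * (1 - f * (v^-1 * s)).
  apply: (mulfI v0); rewrite mulfV // mulrCA mulrBr mulr1.
  rewrite [f * _]mulrCA [v * (_ * _)]mulrA mulfV // mul1r [f * s]mulrC.
  by rewrite /v addrK cV.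
by apply: (ZM) => //; apply: ZB => //; apply: ZM.
Qed.

(** * Uniqueness of the point where x has a pole *)

Section PlaceAtInfinity.
Variable O : {pred L}.
Hypotheses (O_pt : is_point x O) (xO : x \notin O).

Let O_ring := point_subring O_pt.
Let O_cst := point_cst O_pt.

Let uO : u \in O.
Proof. by case: (point_val O_pt function_field_x) => // xO'; move: xO; rewrite xO'. Qed.

Let TO : T \notin O.
Proof.
apply: contra xO => TO; have [O1 OB OM] := O_ring.
(* x - T^d = x (1 - (1 - u)^b) is x u = 1 times a geometric sum. *)
have -> : x = T ^+ d + \sum_(i < b) (1 - u) ^+ i.
  rewrite curve_eq; apply: (mulfI (invr_neq0 x_neq0)).
  rewrite mulrDr mulrA mulVf ?x_neq0 // mul1r.
  have := subrX1 (1 - u) b; rewrite addrAC subrr add0r mulNr => E.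
  by rewrite -[u * _]opprK -E opprB addrC subrK.
apply: subring_closedD => //; first exact: subring_closedX.
by apply: subring_closed_sum => // i _; apply: subring_closedX => //; apply: OB.
Qed.

Let sO : s \in O.
Proof. by case: (point_val O_pt function_field_T) => // TO'; move: TO; rewrite TO'. Qed.

Let B : {pred L} := [predI O & reg].
Let B_ring : subring_closed B.
Proof.
have [O1 OB OM] := O_ring; have [r1 rB rM] := reg_ring.
split; first by rewrite inE O1.
  by move=> f g /andP[fO fr] /andP[gO gr]; apply/andP; split; [apply: OB | apply: rB].
by move=> f g /andP[fO fr] /andP[gO gr]; apply/andP; split; [apply: OM | apply: rM].
Qed.
Let B_cst c : lcst c \in B.
Proof. by apply/andP; split; [apply: O_cst | apply: lregular_cst]. Qed.
Let sB : s \in B.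
Proof. by apply/andP; split; [apply: sO | apply: lTV_regular]. Qed.

Let ev (q : {poly k}) := (map_poly (@lcst k) q).[s].

Let evB q : ev q \in B.
Proof.
rewrite /ev horner_coef; have [_ _ BM] := B_ring.
apply: subring_closed_sum => // i _; rewrite coef_map.
by apply: BM; [apply: B_cst | apply: subring_closedX].
Qed.

Let evX q c : ev (q * 'X + c%:P) = ev q * s + lcst c.
Proof. by rewrite /ev rmorphD rmorphM /= map_polyX map_polyC /= hornerMXaddC. Qed.

(* Elements congruent to polynomials in s modulo s^N, at both O and infty. *)
Let RN N : {pred L} := fun f =>
  `[< exists q, exists2 h, h \in B & f = ev q + s ^+ N * h >].

Let RN_ring N : subring_closed (RN N).
Proof.
have [B1 BB BM] := B_ring.
split=> [|_ _ /asboolP[q [h hB ->]] /asboolP[r [g gB ->]]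
         |_ _ /asboolP[q [h hB ->]] /asboolP[r [g gB ->]]].
- apply/asboolP; exists 1, 0; first exact: subring_closed0.
  by rewrite /ev rmorph1 hornerC mulr0 addr0.
- apply/asboolP; exists (q - r), (h - g); first exact: BB.
  by rewrite /ev rmorphB hornerD hornerN mulrBr opprD addrACA.
apply/asboolP; exists (q * r), (ev q * g + h * ev r + s ^+ N * (h * g)).
  apply: subring_closedD => //; first apply: subring_closedD => //.
  - exact: (BM).
  - exact: (BM).
  by apply: (BM); [apply: subring_closedX | apply: BM].
have -> : ev (q * r) = ev q * ev r by rewrite /ev rmorphM hornerM.
exact: residue_mul.
Qed.

(** Elements with one and the same expansion in s at O and at infty. Through them the abstract ring
    O is compared with Laurent series. *)
Let R0 : {pred L} := fun f => `[< forall N, f \in RN N >].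

Let R0_ring : subring_closed R0.
Proof.
split.
- by apply/asboolP => N; case: (RN_ring N).
- move=> f g /asboolP fR /asboolP gR; apply/asboolP => N.
  by have [_ RB _] := RN_ring N; apply: RB; [apply: fR | apply: gR].
move=> f g /asboolP fR /asboolP gR; apply/asboolP => N.
by have [_ _ RM] := RN_ring N; apply: RM; [apply: fR | apply: gR].
Qed.

Let R0_cst c : lcst c \in R0.
Proof.
apply/asboolP => N; apply/asboolP; exists c%:P, 0; first exact: subring_closed0.
by rewrite /ev map_polyC hornerC mulr0 addr0.
Qed.

Let R0_s : s \in R0.
Proof.
apply/asboolP => N; apply/asboolP; exists 'X, 0; first exact: subring_closed0.
by rewrite /ev map_polyX hornerX mulr0 addr0.
Qed.

Let uB : u \in B.
Proof.
apply/andP; split; first exact: uO.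
by case: (lregular_val x) => // xr; have [_ /negP] := expx.
Qed.

(** In u = s^d (1 - u)^b, an approximation of u on the right modulo s^N gives one on the left modulo
    s^(N+d). *)
Let R0_u : u \in R0.
Proof.
apply/asboolP; elim=> [|N IHN].
  apply/asboolP; exists 0, u; first exact: uB.
  by rewrite /ev rmorph0 horner0 add0r mul1r.
have [R1 RB RM] := RN_ring N.
have /asboolP[q [h hB E]] : (1 - u) ^+ b \in RN N.
  by apply: subring_closedX; [apply: RN_ring | apply: RB].
apply/asboolP; exists ('X^d * q), (s ^+ d.-1 * h).
  by have [_ _ BM] := B_ring; apply: BM => //; apply: subring_closedX.
have -> : ev ('X^d * q) = s ^+ d * ev q.
  by rewrite /ev rmorphM hornerM /= map_polyXn hornerXn.
rewrite {1}curve_eq_inv E mulrDr mulrA -exprD [s ^+ N.+1 * _]mulrA -exprD.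
by congr (_ + s ^+ _ * _); lia.
Qed.

Let cst_small c f : f \in reg -> lcst c = s * f -> c = 0.
Proof.
move=> fr E; apply/eqP; apply: contraTT fr => c0.
have -> : f = T * lcst c by rewrite E mulrA mulfV ?mul1r.
by rewrite (pole_order_regular (pole_orderM (pole_order_T k) (pole_order_cst c0))).
Qed.

Let polyMX_C (q : {poly k}) : exists r c, q = r * 'X + c%:P.
Proof.
elim/poly_ind: q => [|q c _]; last by exists q, c.
by exists 0, 0; rewrite mul0r add0r.
Qed.

Let R0_decomp f : f \in R0 -> exists c, exists2 g, g \in R0 & f = lcst c + s * g.
Proof.
move=> fR; have /asboolP fN := fR.
have /asboolP[q [h /andP[_ hr] fq]] := fN 1%N.
have [q' [c qE]] := polyMX_C q.
exists c, (T * (f - lcst c)); last first.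
  by rewrite mulrA mulVf // mul1r addrC subrK.
apply/asboolP => N; have /asboolP[r [g gB fr]] := fN N.+1.
have [r' [c' rE]] := polyMX_C r.
(* The approximations modulo s and modulo s^(N+1) have equal constant terms, because a constant
   divisible by s in the regular series is 0. *)
have cc : c' = c.
  have rB q0 : ev q0 \in reg by have /andP[] := evB q0.
  have /andP[_ gr] := gB; have [_ rsB rM] := reg_ring.
  have sr := lTV_regular k.
  apply/eqP; rewrite -subr_eq0; apply/eqP.
  apply: (@cst_small _ (ev q' + h - ev r' - s ^+ N * g)).
    apply: (rsB); first apply: (rsB) => //; first exact: subring_closedD.
    by apply: (rM) => //; apply: subring_closedX.
  rewrite rmorphB; move: fr; rewrite fq qE rE !evX [s ^+ N.+1]exprS => fr.
  exact: residue_eq fr.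
apply/asboolP; exists r', g => //.
rewrite fr rE evX cc addrAC addrK mulrDr [ev r' * s]mulrC !mulrA mulfV // mul1r.
by rewrite exprS mulrA mulfV // mul1r.
Qed.

(** Factors s are stripped off until the constant term is nonzero; then [unit_near_cst] applies at O
    and at infty alike. *)
Let R0_unit m f : f \in R0 -> pole_order f (- m%:Z) ->
  exists w, [/\ w \in O, w^-1 \in O, w \in reg, w^-1 \in reg & f = s ^+ m * w].
Proof.
have R0B h : h \in R0 -> h \in B.
  move=> /asboolP/(_ 0%N)/asboolP[q [g gB ->]]; rewrite mul1r.
  exact: subring_closedD.
elim: m f => [|m IHm] f fR fm.
  have [c [g gR fE]] := R0_decomp fR.
  have /andP[gO gr] := R0B _ gR; have /andP[fO fr] := R0B _ fR.
  have c0 : c != 0.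
    apply: contraTneq gr => c0.
    have -> : g = T * f by rewrite fE c0 rmorph0 add0r mulrA mulfV ?mul1r.
    by rewrite (pole_order_regular (pole_orderM (pole_order_T k) fm)).
  exists f; split=> //; last by rewrite mul1r.
    rewrite fE; apply: unit_near_cst => //.
    apply: (point_val O_pt); rewrite -fE; have [_ _ KM] := function_field_subring.
    by apply: KM; [apply: (point_sub O_pt) | apply: function_field_T].
  rewrite fE; apply: unit_near_cst => //; first exact: lregular_cst.
    exact: lT_regularN.
  exact: lregular_val.
have [c [g gR fE]] := R0_decomp fR; have /andP[_ gr] := R0B _ gR.
have Tfm : pole_order (T * f) (- m%:Z).
  have -> : - m%:Z = 1 + - m.+1%:Z by rewrite intS opprD addrA subrr add0r.
  exact: pole_orderM (pole_order_T k) fm.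
have TfE : T * f = T * lcst c + g by rewrite fE mulrDr mulrA mulfV // mul1r.
have c0 : c = 0.
  have cr : T * f - g \in reg.
    have [_ rB _] := reg_ring; apply: rB => //.
    by rewrite (pole_order_regular Tfm); lia.
  apply: (cst_small cr); rewrite TfE addrK mulrA mulVf // mul1r //.
have gm : pole_order g (- m%:Z) by move: Tfm; rewrite TfE c0 rmorph0 mulr0 add0r.
have [w [wO wVO wr wVr gE]] := IHm g gR gm.
by exists w; split=> //; rewrite fE c0 rmorph0 add0r gE exprS mulrA.
Qed.

Let FR : {pred L} := fun f =>
  `[< exists g h, [/\ g \in R0, h \in R0, h != 0 & f = g / h] >].

Let FR_divring : divring_closed FR.
Proof.
have [R1 RB RM] := R0_ring; split.
- by apply/asboolP; exists 1, 1; rewrite divr1 oner_neq0.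
- move=> _ _ /asboolP[g [h [gR hR h0 ->]]] /asboolP[g' [h' [gR' hR' h0' ->]]].
  apply/asboolP; exists (g * h' - g' * h), (h * h'); split.
  + by apply: RB; apply: (RM).
  + exact: RM.
  + exact: mulf_neq0.
  by rewrite -mulNr addf_div // mulNr.
move=> _ _ /asboolP[g [h [gR hR h0 ->]]] /asboolP[g' [h' [gR' hR' h0' ->]]].
have [->|g0'] := eqVneq g' 0.
  apply/asboolP; exists 0, 1; split.
  - exact: subring_closed0.
  - exact: R1.
  - exact: oner_neq0.
  by rewrite !mul0r invr0 mulr0.
apply/asboolP; exists (g * h'), (h * g'); split; try exact: RM.
  exact: mulf_neq0.
by rewrite invf_div mulf_div.
Qed.

Let field_frac f : f \in K -> f \in FR.
Proof.
move=> /asboolP; apply => [|c||].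
- exact: FR_divring.
- apply/asboolP; exists (lcst c), 1; rewrite divr1 oner_neq0.
  by have [] := R0_ring.
- apply/asboolP; exists 1, u; rewrite invr_neq0 ?x_neq0 // invrK mul1r.
  by have [] := R0_ring.
apply/asboolP; exists 1, (s * u); have [R1 _ RM] := R0_ring.
split=> //; first exact: RM.
  exact: mulf_neq0 (invr_neq0 T0) (invr_neq0 x_neq0).
by rewrite invfM !invrK mul1r.
Qed.

(** Every nonzero function is s^(m-n) times an element invertible in both rings. As both contain s
    but not T, membership in either means n <= m. *)
Lemma place_at_infty : O =i infty x.
Proof.
have inf_mem f : (f \in infty x) = (f \in K) && (f \in reg) by [].
move=> f; rewrite inf_mem; have [fK|fK] := boolP (f \in K); last first.
  by apply: contraNF fK; apply: (point_sub O_pt).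
have [->|f0] := eqVneq f 0; first by rewrite !subring_closed0.
have /asboolP[g [h [gR hR h0 fE]]] := field_frac fK.
have g0 : g != 0 by apply: contraNneq f0 => g0; rewrite fE g0 mul0r.
have ord e : e \in R0 -> e != 0 -> exists m : nat, pole_order e (- m%:Z).
  move=> eR e0; have [n en] := pole_order_ex e0; exists `|n|%N.
  suff n0 : n <= 0 by rewrite opp_absz_nonpos.
  rewrite -(pole_order_regular en).
  have /asboolP/(_ 0%N)/asboolP[q [e' e'B ->]] := eR; rewrite mul1r.
  by have /andP[] : ev q + e' \in B by apply: subring_closedD.
have [m gm] := ord g gR g0; have [n hn] := ord h hR h0.
have [v [vO vVO vr vVr gE]] := R0_unit gR gm.
have [w [wO wVO wr wVr hE]] := R0_unit hR hn.
have [O1 OB OM] := O_ring; have [r1 rB rM] := reg_ring.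
have {}fE : f = s ^+ m / s ^+ n * (v / w) by rewrite fE gE hE mulf_div.
have vwO : v / w \in O by apply: OM.
have vwr : v / w \in reg by apply: rM.
have s0 : s != 0 by rewrite invr_neq0.
have [le_nm|lt_mn] := leqP n m.
  have -> : f = s ^+ (m - n) * (v / w) by rewrite fE expfB_cond ?(negPf s0).
  by rewrite OM ?rM //; apply: subring_closedX => //; apply: lTV_regular.
have fT : T ^+ (n - m).-1.+1 = f * (w / v).
  have v0 : v != 0 by apply: contraNneq g0 => v0; rewrite gE v0 mulr0.
  have w0 : w != 0 by apply: contraNneq h0 => w0; rewrite hE w0 mulr0.
  have vw : v / w * (w / v) = 1 by rewrite mulf_div [w * v]mulrC mulfV ?mulf_neq0.
  rewrite prednK ?subn_gt0 // fE -[RHS]mulrA vw mulr1 -[(s ^+ n)^-1]exprVn invrK.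
  by rewrite exprV_mul // ltnW.
have -> : (f \in O) = false.
  apply: contraNF (lT_expN (n - m).-1 O_ring sO TO) => fO; rewrite fT.
  by apply: (OM) => //; apply: (OM).
symmetry; apply: contraNF (lT_expN (n - m).-1 reg_ring (lTV_regular k) (lT_regularN k)).
by move=> fr; rewrite fT; apply: (rM) => //; apply: (rM).
Qed.
End PlaceAtInfinity.
End Curve.

Lemma expansion_exists (k : fieldType) (d a b : nat) :
  (0 < d)%N -> (a + b = d.+1)%N -> exists x : laurent k, expansion_at_infty d a b x.
Proof.
move=> d_gt0 abE.
(* [powserX] stands for s and w for u = 1/x: the equation of [curve_eq_inv] is a contraction on
   regular series. *)
have [|w wE] := @powser_fix k (fun w => powserX k ^+ d * (1 - w) ^+ b).
  move=> n f g fg; rewrite -(prednK d_gt0) exprS -!mulrA; apply: peqMX.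
  by apply: peqM => //; apply: peq_exp; apply: peqD => //; apply: peqN.
have w_coef0 : pcoef w 0 = 0.
  by rewrite -wE -(prednK d_gt0) exprS -mulrA pcoefX_mul0.
have w0 : w != 0.
  apply/eqP => w0; move: wE; rewrite w0 subr0 expr1n mulr1 => /eqP.
  by rewrite expf_eq0 d_gt0 /= => /eqP/(congr1 (fun f => pcoef f 1)) /= /eqP; rewrite oner_eq0.
have U0 : lseries w != 0.
  by rewrite -(rmorph0 (@lseries k)) (inj_eq (@lseries_inj k)).
have UE : (1 - lseries w) ^+ b = lT k ^+ d * lseries w.
  have /(congr1 (@lseries k)) := wE; rewrite rmorphM !rmorphXn rmorphB rmorph1 /= => E.
  by rewrite -[in RHS]E -lTV mulrA -exprMn mulfV ?lT_neq0 // expr1n mul1r.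
exists (lseries w)^-1; split; last first.
  apply/negP => /lregularP[v wv]; have : w * v = 1.
    by apply: lseries_inj; rewrite rmorphM rmorph1 /= -wv mulfV.
  move/(congr1 (fun f => pcoef f 0)); rewrite pcoef0_mul w_coef0 mul0r => /eqP.
  by rewrite eq_sym oner_eq0.
move: (lseries w) U0 UE => U U0 UE.
have -> : U^-1 - 1 = (1 - U) * U^-1 by rewrite mulrBl mul1r mulfV.
rewrite !exprMn UE mulrCA -exprD -mulrA; congr (_ * _).
rewrite abE exprS mulrA mulfV // mul1r //.
Qed.

Lemma signed_bin_rec (S : comNzRingType) M n (x y t z : S) :
  x - y - ((-1) ^+ n.+1 * ('C(M.+1, n.+1))%:R) * t
  = (x - ((-1) ^+ n.+1 * ('C(M, n.+1))%:R) * t) - (y - ((-1) ^+ n * ('C(M, n))%:R) * t).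
Proof. by rewrite binS natrD exprS; ring. Qed.

(** * Functions regular away from infinity, gaps, and the coefficient of T *)

Section CurveSections.
Variables (k : fieldType) (d a b : nat) (x : laurent k).
Local Notation L := (laurent k).
Local Notation T := (lT k).
Local Notation reg := (@lregular k).
Local Notation K := (function_field x).
Local Notation A := (sections_away_infty x).
Hypothesis k_char0 : forall n, (0 < n)%N -> n%:R != 0 :> k.
Hypotheses (a_bounds : (1 < a < d)%N) (bE : b = (d + 1 - a)%N).
Hypothesis expx : expansion_at_infty d a b x.

Local Notation s := (T^-1).
Local Notation u := (x^-1).

Let T0 : T != 0. Proof. exact: lT_neq0. Qed.
Let reg_ring : subring_closed reg. Proof. exact: lregular_subring. Qed.
Let K_ring : subring_closed K. Proof. exact: function_field_subring. Qed.
Let x0 : x != 0. Proof. exact: x_neq0 expx. Qed.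

Lemma sections_subring : subring_closed A.
Proof.
have [K1 KB KM] := K_ring; split.
- by apply/asboolP; split=> // O Opt _; case: (point_subring Opt).
- move=> f g /asboolP[fK fO] /asboolP[gK gO]; apply/asboolP; split; first exact: KB.
  move=> O Opt OI; have [_ OB _] := point_subring Opt.
  by apply: OB; [apply: fO | apply: gO].
move=> f g /asboolP[fK fO] /asboolP[gK gO]; apply/asboolP; split; first exact: KM.
move=> O Opt OI; have [_ _ OM] := point_subring Opt.
by apply: OM; [apply: fO | apply: gO].
Qed.

Lemma sections_cst c : lcst c \in A.
Proof.
apply/asboolP; split; first exact: function_field_cst.
by move=> O Opt _; apply: (point_cst Opt).
Qed.

Let point_x O : is_point x O -> ~ (O =i infty x) -> x \in O.
Proof.
move=> Opt OI; apply/negPn/negP => xO; apply: OI.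
exact: place_at_infty a_bounds bE expx _ Opt xO.
Qed.

Lemma sections_x : x \in A.
Proof. by apply/asboolP; split; [apply: function_field_x | apply: point_x]. Qed.

Lemma sections_y : T * x \in A.
Proof.
apply/asboolP; split=> [|O Opt OI]; first exact: function_field_y.
have Or := point_subring Opt; have [O1 OB OM] := Or; have xO := point_x Opt OI.
case: (point_val Opt (function_field_y x)) => // yV.
have [y0|y0] := eqVneq (T * x) 0; first by rewrite y0; apply: subring_closed0.
have [eq_xy _] := expx; have d_gt0 : (0 < d)%N by lia.
(* A valuation ring is integrally closed: y is y^d times a power of 1/y, and y^d is a polynomial in
   x. *)
have -> : T * x = (T * x) ^+ d * (T * x)^-1 ^+ d.-1.
  by rewrite -{1}(prednK d_gt0) exprS -mulrA -exprMn mulfV // expr1n mulr1.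
rewrite eq_xy; apply: (OM); last exact: subring_closedX.
by apply: (OM); apply: subring_closedX => //; apply: OB.
Qed.

(** The function h = 1/f has a pole at infty, so 1/h is not a polynomial in h. A valuation ring that
    contains k[h] and omits f is a point, different from infty where f is regular, and f has a pole
    there. *)
Lemma no_zero_at_infty f n : f \in A -> pole_order f n -> n < 0 -> False.
Proof.
move=> fA fn n0; have f0 := pole_order_neq0 fn; have /asboolP[fK fO] := fA.
pose h := f^-1; have hn : pole_order h (- n) by apply: pole_orderV.
have hn0 : 0 < - n by rewrite oppr_gt0.
pose ev (q : {poly k}) := (map_poly (@lcst k) q).[h].
pose B0 : {pred L} := fun g => `[< exists q, g = ev q >].
have B0_ring : subring_closed B0.
  split.
  - by apply/asboolP; exists 1; rewrite /ev rmorph1 hornerC.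
  - move=> _ _ /asboolP[q ->] /asboolP[r ->]; apply/asboolP; exists (q - r).
    by rewrite /ev rmorphB hornerD hornerN.
  move=> _ _ /asboolP[q ->] /asboolP[r ->]; apply/asboolP; exists (q * r).
  by rewrite /ev rmorphM hornerM.
have hK : h \in K by apply: divringV fK; apply: function_field_divring.
have B0K : {subset B0 <= K}.
  move=> _ /asboolP[q ->]; rewrite /ev horner_coef.
  apply: subring_closed_sum => // i _; rewrite coef_map; have [_ _ KM] := K_ring.
  by apply: KM; [apply: function_field_cst | apply: subring_closedX].
(* From f = q(h) would follow h q(h) - 1 = 0, against [horner_pole_order]. *)
have fB0 : f \notin B0.
  apply/negP => /asboolP[q fq].
  have q1 : q * 'X - 1 != 0.
    apply/eqP => /(congr1 (fun r : {poly k} => r`_0)).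
    rewrite coefB coefMX coef1 coef0 sub0r /= => /eqP.
    by rewrite oppr_eq0 oner_eq0.
  have /pole_order_neq0/eqP[] := horner_pole_order hn hn0 q1.
  by rewrite rmorphB rmorphM /= map_polyX rmorph1 !hornerE -/(ev q) -fq mulfV ?subrr.
have hB0 : f^-1 \in B0 by apply/asboolP; exists 'X; rewrite /ev map_polyX hornerX.
have [O [B0O OK Or fNO Oval]] :=
  valuation_extension (function_field_divring x) B0_ring B0K fB0 hB0.
have /negP[] := fNO; apply: fO.
  split=> //; last by move=> KO; rewrite (KO _ fK) in fNO.
  move=> c; apply: B0O; apply/asboolP; exists c%:P.
  by rewrite /ev map_polyC hornerC.
move=> /(_ f); rewrite (negPf fNO) => /esym/negP[]; apply/andP; split=> //.
by rewrite (pole_order_regular fn) ltW.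
Qed.

(** Powers of f realise every pole order, so leading terms can be subtracted until
    [no_zero_at_infty] leaves only 0. *)
Lemma sections_generated f : f \in A -> pole_order f 1 ->
  forall g, g \in A -> exists q : {poly k}, g = (map_poly (@lcst k) q).[f].
Proof.
move=> fA f1; have Ar := sections_subring; have [A1 AB AM] := Ar.
suff gen N g : g \in A -> g = 0 \/ (exists2 n, pole_order g n & n < N%:Z) ->
    exists q : {poly k}, g = (map_poly (@lcst k) q).[f].
  move=> g gA; have [g0|g0] := eqVneq g 0; first by apply: (gen 0%N) => //; left.
  have [n gn] := pole_order_ex g0; apply: (gen `|n|.+1%N) => //; right; exists n => //.
  by rewrite intS; lia.
elim: N g => [|N IHN] g gA [->|[n gn nN]].
- by exists 0; rewrite rmorph0 horner0.
- by case: (no_zero_at_infty gA gn nN).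
- by exists 0; rewrite rmorph0 horner0.
have [nN'|Nn] := ltrP n N%:Z; first by apply: IHN => //; right; exists n.
have {nN Nn}nE : n = N%:Z by move: nN Nn; rewrite intS; lia.
have := pole_orderX N f1; rewrite mul1r -nE => fN.
have [c c0 gc] := pole_order_sub gn fN.
have gcA : g - lcst c * f ^+ N \in A.
  by apply: AB => //; apply: AM; [apply: sections_cst | apply: subring_closedX].
have [|q qE] := IHN _ gcA.
  case: gc => [->|[m mn gm]]; [by left | right; exists m => //].
  by rewrite -nE.
exists (q + c *: 'X^N); rewrite rmorphD /= map_polyZ map_polyXn hornerD -qE.
by rewrite hornerZ hornerXn subrK.
Qed.

(** The pole order of x gives deg P = d. The equation of the curve, which holds for P(f) and Q(f),
    holds for P and Q because f is transcendental. *)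
Lemma no_simple_pole f : f \in A -> pole_order f 1 -> False.
Proof.
move=> fA f1; have gen := sections_generated fA f1.
have [P PE] := gen _ sections_x; have [Q QE] := gen _ sections_y.
have size_ev (q : {poly k}) n : pole_order (map_poly (@lcst k) q).[f] n%:Z ->
    size q = n.+1.
  move=> qn; have q0 : q != 0.
    by apply: contraTneq (pole_order_neq0 qn) => ->; rewrite rmorph0 horner0 eqxx.
  have := pole_order_inj (horner_pole_order f1 ltr01 q0) qn; rewrite mul1r => -[<-].
  by rewrite prednK // size_poly_gt0.
have sP : size P = d.+1.
  by apply: size_ev; rewrite -PE; apply: pole_order_x a_bounds bE expx.
apply: (no_parametrization k_char0 a_bounds bE sP (Q := Q)).
apply/eqP; rewrite -subr_eq0; apply: contraT => R0.
have /pole_order_neq0/eqP[] := horner_pole_order f1 ltr01 R0.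
rewrite rmorphB hornerD hornerN rmorphM hornerM !rmorphXn !horner_exp rmorphB.
rewrite rmorph1 hornerD hornerN hornerC -PE -QE; have [-> _] := expx.
by rewrite subrr.
Qed.

Lemma sections_inftyE f n m : pole_order f n ->
  (f \in sections_infty x m) = (f \in A) && (n <= m).
Proof.
move=> fn; have Tm : pole_order (T ^ (- m)) (- m).
  by exists 1; rewrite ?oner_neq0 // rmorph1 mulr1.
have -> : (f \in sections_infty x m) = (f \in A) && (T ^ (- m) * f \in reg) by [].
by rewrite (pole_order_regular (pole_orderM Tm fn)) addrC subr_le0.
Qed.

Lemma gap1 : gap x 1.
Proof.
move=> f; have [->|f0] := eqVneq f 0.
  have sec0 m : (0 \in sections_infty x m) = (0 \in A) && (T ^ (- m) * 0 \in reg) by [].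
  by rewrite !sec0 !mulr0.
have [n fn] := pole_order_ex f0; rewrite !(sections_inftyE _ fn).
have [fA|//] := boolP (f \in A); rewrite /= subrr.
apply/idP/idP => [n1|n0]; last exact: le_trans n0 _.
rewrite leNgt; apply/negP => n0; apply: (no_simple_pole fA).
by have -> : 1 = n by lia.
Qed.

Lemma not_gap f (n : nat) : f \in A -> pole_order f n -> ~ gap x n.
Proof.
move=> fA fn /(_ f); rewrite !(sections_inftyE _ fn) fA /= lexx => /esym.
by rewrite lerBrDr gerDl.
Qed.

Lemma not_gap0 : ~ gap x 0.
Proof.
apply: (@not_gap (lcst 1)); first exact: sections_cst.
exact/pole_order_cst/oner_neq0.
Qed.

(** x^i y^j has pole order d i + (d + 1) j. Take j = n mod d and i = n/d - j, which is nonnegative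
    since n/d >= d > j. The crude bound is enough to make the list of gaps finite. *)
Lemma not_gap_large n : (d * d <= n)%N -> ~ gap x n.
Proof.
move=> le_n; have Ar := sections_subring; have [A1 AB AM] := Ar.
have d_gt0 : (0 < d)%N by lia.
pose j := (n %% d)%N; pose i := (n %/ d - j)%N.
have lt_j : (j < d)%N by rewrite ltn_mod.
have le_d : (d <= n %/ d)%N by rewrite leq_divRL.
have nE : (n = d * i + d.+1 * j)%N.
  rewrite {1}(divn_eq n d) -/j /i mulnBr mulSn addnA addnAC subnK ?leq_mul //.
    by rewrite mulnC.
  exact: leq_trans (ltnW lt_j) le_d.
apply: (@not_gap (x ^+ i * (T * x) ^+ j)).
  by apply: AM; apply: subring_closedX => //; [apply: sections_x | apply: sections_y].
rewrite {1}nE PoszD !PoszM.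
exact: pole_orderM (pole_orderX i (pole_order_x a_bounds bE expx))
                   (pole_orderX j (pole_order_y a_bounds bE expx)).
Qed.

Lemma gap_sequence_exists : exists mu, gap_sequence x mu.
Proof.
exists [seq n <- iota 0 (d * d) | `[< gap x n >]]; split.
  by apply: sorted_filter (iota_ltn_sorted _ _); apply: ltn_trans.
move=> n; rewrite mem_filter mem_iota add0n /=; split=> [/andP[/asboolP]//|gn].
rewrite ltnNge; apply/andP; split; first exact/asboolP.
by apply/negP => /not_gap_large.
Qed.

Lemma first_gap mu : gap_sequence x mu -> (0 < size mu)%N /\ nth 0%N mu 0 = 1%N.
Proof.
move=> [mu_sorted muP]; have mu1 : 1%N \in mu by apply/muP/gap1.
have mu0 : 0%N \notin mu by apply/negP => /muP/not_gap0.
case: mu mu_sorted {muP} mu1 mu0 => //= m mu m_path.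
rewrite inE => /orP[/eqP<-//|mu1] m0; split=> //.
have /allP/(_ 1%N mu1) : all (ltn m) mu by apply: order_path_min m_path; apply: ltn_trans.
by case: m m0 {m_path}.
Qed.

Lemma in_A_plusB f g : in_A_plus x f -> in_A_plus x g -> in_A_plus x (f - g).
Proof.
move=> [f' fA [v ->]] [g' gA [w ->]]; have [_ AB _] := sections_subring.
exists (f' - g'); first exact: AB.
by exists (v - w); rewrite rmorphB mulrBr opprD addrACA.
Qed.

Lemma in_A_plus_section f : f \in A -> in_A_plus x f.
Proof. by move=> fA; exists f => //; exists 0; rewrite rmorph0 mulr0 addr0. Qed.

Lemma in_A_plus_small f n : pole_order f n -> n < 0 -> in_A_plus x f.
Proof.
move=> fn n0; exists 0; first exact/subring_closed0/sections_subring.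
have /lregularP[v vE] : T * f \in reg.
  rewrite (pole_order_regular (pole_orderM (pole_order_T k) fn)).
  by rewrite -lerBrDl sub0r -ltzD1 addrC subrr.
by exists v; rewrite add0r -vE mulrA mulVf // mul1r.
Qed.

(* The coefficient of T modulo A + (1/T) k[[1/T]], by Pascal's rule on M. *)
Lemma in_A_plus_bin M n :
  in_A_plus x (T * x ^+ n * (1 - u) ^+ M - lcst ((-1) ^+ n * ('C(M, n))%:R) * T).
Proof.
have Ar := sections_subring; have [A1 AB AM] := Ar.
have cE N m : lcst ((-1) ^+ m * ('C(N, m))%:R : k) = (-1) ^+ m * ('C(N, m))%:R.
  by rewrite rmorphM rmorphXn rmorphN rmorph1 rmorph_nat.
elim: M n => [|M IHM] n.
  (* For M = 0 the binomial is nonzero only at n = 0; for larger n the product T x^n = y x^(n-1) is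
     already in A. *)
  rewrite cE expr0 mulr1; case: n => [|n].
    rewrite bin0 expr0 !mul1r mulr1 subrr.
    exact/in_A_plus_section/subring_closed0.
  rewrite bin0n mulr0 mul0r subr0; apply: in_A_plus_section.
  rewrite exprS mulrA; apply: AM; first exact: sections_y.
  by apply: subring_closedX => //; apply: sections_x.
case: n => [|n].
  (* For n = 0 the subtracted term T u (1 - u)^M contributes nothing: u has a zero of order d > 1 at
     infty. *)
  have := IHM 0%N; rewrite !bin0 => IH0.
  have -> : T * x ^+ 0 * (1 - u) ^+ M.+1 - lcst ((-1) ^+ 0 * 1%:R) * T =
      (T * x ^+ 0 * (1 - u) ^+ M - lcst ((-1) ^+ 0 * 1%:R) * T) - T * u * (1 - u) ^+ M.
    by rewrite exprS expr0; move: (_ ^+ M) (lcst _) => p q; ring.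
  have [->|v0] := eqVneq (T * u * (1 - u) ^+ M) 0; first by rewrite subr0.
  apply: in_A_plusB => //; have [m vm] := pole_order_ex v0.
  have xd := pole_order_x a_bounds bE expx.
  have Tu : pole_order (T * u) (1 - d%:Z).
    exact: pole_orderM (pole_order_T k) (pole_orderV xd).
  have ur : u \in reg by rewrite (pole_order_regular (pole_orderV xd)) oppr_le0.
  have wr : (1 - u) ^+ M \in reg.
    by apply: subring_closedX => //; have [r1 rB _] := reg_ring; apply: rB.
  have w0 : (1 - u) ^+ M != 0 by apply: contraNneq v0 => ->; rewrite mulr0.
  have [r wr'] := pole_order_ex w0.
  have r0 : r <= 0 by rewrite -(pole_order_regular wr').
  apply: (in_A_plus_small (pole_orderM Tu wr')).
  by lia.
have -> : T * x ^+ n.+1 * (1 - u) ^+ M.+1 =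
    T * x ^+ n.+1 * (1 - u) ^+ M - T * x ^+ n * (1 - u) ^+ M.
  have -> : x ^+ n = x ^+ n.+1 * u by rewrite exprSr mulfK.
  by rewrite [(1 - u) ^+ M.+1]exprS; move: ((1 - u) ^+ M) (x ^+ n.+1) => p q; ring.
by rewrite cE signed_bin_rec // -!cE; apply: in_A_plusB.
Qed.

Lemma in_A_plus_T n : in_A_plus x
  (T ^+ (d * n).+1 - lcst ((-1) ^+ n * ('C(n * b, n))%:R) * T).
Proof.
have -> : T ^+ (d * n).+1 = T * x ^+ n * (1 - u) ^+ (n * b).
  by rewrite exprS exprM (curve_eq a_bounds bE expx) exprMn -exprM mulrA [(b * n)%N]mulnC.
exact: in_A_plus_bin.
Qed.

Lemma in_A_plus_unique f c c' : in_A_plus x (f - lcst c * T) ->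
  in_A_plus x (f - lcst c' * T) -> c = c'.
Proof.
move=> fc /in_A_plusB/(_ fc); have -> : f - lcst c' * T - (f - lcst c * T) = lcst (c - c') * T.
  by rewrite rmorphB /=; move: (lcst c) (lcst c') => e e'; ring.
case=> g gA [v gE]; apply/eqP; rewrite -subr_eq0; apply/negPn/negP => cc.
apply: (no_simple_pole gA).
(* By [gE], g = (c - c') T - s v = T (c - c' - s^2 v). *)
exists (powser_cst (c - c') - powserX k * (powserX k * v)).
  have -> : pcoef (powser_cst (c - c') - powserX k * (powserX k * v)) 0
    = pcoef (powser_cst (c - c')) 0 - pcoef (powserX k * (powserX k * v)) 0 by [].
  by rewrite pcoefX_mul0 subr0.
have -> : lseries (powser_cst (c - c') - powserX k * (powserX k * v))
    = lcst (c - c') - s * (s * lseries v) by rewrite rmorphB !rmorphM /= -lTV.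
rewrite expr1z mulrBr [T * (s * _)]mulrA mulfV // mul1r [T * _]mulrC gE.
by rewrite addrK.
Qed.
End CurveSections.

Theorem proposition5p3 (p d a : nat) (p_pr : prime p) (d_pr : prime d)
    (d_odd : odd d) (p_mod_d : (p = 1 %[mod d])%N) (a_bounds : (1 < a < d)%N) :
  let b := (d + 1 - a)%N in
  let l1 := ptypical_series (fun k =>
    ('C((p ^ k - 1) %/ d * b, (p ^ k - 1) %/ d)%N)%:R : padic_int p_pr) in
  exists F : mseries 2 (padic_int p_pr),
    [/\ is_formal_group F,
        is_log (@padic_of_int p p_pr) l1 F,
        exists G : mseries 2 (padic_int p_pr), is_Jhat d a b 1 G &
        forall G : mseries 2 (padic_int p_pr), is_Jhat d a b 1 G -> fg_isomorphic F G].
Proof.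
move=> b l1; have b_bounds : (1 < b < d)%N by rewrite /b; lia.
have p_gt0 := prime_gt0 p_pr.
have [r rP] := padic_ratio_limit p_pr
  (coprime_cbin p_pr p_mod_d b_bounds) (cbin_sqr p_pr p_mod_d b_bounds).
pose c k : padic_int p_pr := (cbin p d b k)%:R.
have c0 : c 0%N = 1 by rewrite /c /cbin rep_digit0 bin0.
have [F Ffg Flog] := formal_group_ptypical c0 rP.
have k_char0 := padic_natr_neq0 p_pr.
(* p = 2 is excluded by p = 1 mod d, so that the sign (-1)^((p^k - 1)/d) is trivial. *)
have p_odd : odd p.
  apply/negPn/negP => p_even; have p2 : p = 2 by case: (even_prime p_pr) p_even => [->|->].
  move: p_mod_d; rewrite p2 !modn_small //; lia.
have rep_odd k : odd (rep_digit p d k) = false.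
  have /(congr1 odd) := rep_digitK p_pr p_mod_d k.
  by rewrite oddM d_odd andbT => ->; rewrite oddB ?expn_gt0 ?p_gt0 // oddX p_odd orbT.
have coef_T x : expansion_at_infty d a b x -> forall k, in_A_plus x
    (lT (padic p_pr) ^+ (p ^ k) - lcst (padic_of_int (c k)) * lT (padic p_pr)).
  move=> expx k; have := in_A_plus_T a_bounds (erefl b) expx (rep_digit p d k).
  rewrite -signr_odd rep_odd expr0 mul1r [padic_of_int _]rmorph_nat mulnC.
  by rewrite (rep_digitK p_pr p_mod_d) subn1 prednK // expn_gt0 p_gt0.
exists F; split=> //.
  have d_gt0 : (0 < d)%N by apply: prime_gt0.
  have abE : (a + b = d.+1)%N by rewrite /b; lia.
  have [x expx] := expansion_exists (padic p_pr) d_gt0 abE.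
  have [mu muP] := gap_sequence_exists a_bounds (erefl b) expx.
  have [mu_gt0 mu1] := first_gap k_char0 a_bounds (erefl b) expx muP.
  exists F, x, mu, c; split=> //= k; rewrite mu1 mul1n expr1.
  exact: coef_T.
move=> G [x [mu [e [expx muP _ eP [Gfg Glog]]]]].
have [mu_gt0 mu1] := first_gap k_char0 a_bounds (erefl b) expx muP.
(* Whatever expansion x comes with G, its first gap is 1 and the coefficient of T in T^(p^k) is the
   same. *)
have ec : e = c.
  apply: funext => k; apply: padic_of_int_inj.
  apply: (in_A_plus_unique k_char0 a_bounds (erefl b) expx _ (coef_T x expx k)).
  by have := eP k; rewrite mu1 mul1n expr1.
rewrite ec in Glog.
rewrite -(log_unique (@padic_of_int_inj _ _) (formal_group0 Ffg) (formal_group0 Gfg) Flog Glog).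
exact: fg_isomorphic_refl.
Qed.
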